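(* Let $y(E)=(\lambda(E),\mu(E),w(E)^\top,x(E)^\top)^\top$ be the solution of the problem $$y'(E)=J(y(E))^{-1}e_2\quad (E\le E_{\mathrm{uw}}),\qquad y(E_{\mathrm{uw}})=y^*,$$ defined on its maximal interval of existence $(E_{\min},E_{\mathrm{uw}}]$ (with $E_{\min}\ge 0$). Then exactly one of the following alternatives holds: 1. Finite breakdown: $E_{\min}>0$ (the solution cannot be continued below some positive value $E_{\min}$); 2. Extension to zero: $E_{\min}=0$ (the solution extends uniquely to $(0,E_{\mathrm{uw}}]$). If finite breakdown occurs at $E_{\min}>0$, then (at least) one of the following mutually non-exclusive behaviors must take place as $E\downarrow E_{\min}$: (i) $\|y(E)\|\to+\infty$ (escape to infinity); (ii) $y(E)$ remains bounded but approaches the boundary of $\mathcal D$, i.e. some weight $w_i(E)\to 0$; (iii) $y(E)$ remains bounded and inside $\mathcal D$ but $J(y(E))$ becomes singular (loses invertibility).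
   Context: Let $m\ge n$, $A\in\mathbb{R}^{m\times n}$ of full column rank with rows $a_i^\top$, $b\in\mathbb{R}^m$, $u=(1,\dots,1)^\top\in\mathbb{R}^m$, $x^*=(A^\top A)^{-1}A^\top b$, $r^*=Ax^*-b$, $E_{\mathrm{uw}}=\frac1m\|r^*\|_2^2$; it is assumed that $|r^*|$ is not a constant vector. $W=\mathrm{diag}(w)$, $r=Ax-b$; logarithm and squares of vectors are componentwise. For $y=(\lambda,\mu,w^\top,x^\top)^\top$ and a parameter $E$, let $F(y;E)=(F_1,F_2,F_3^\top,F_4^\top)^\top\in\mathbb{R}^{2+m+n}$ with $$F_1=u^\top w-1,\quad F_2=w^\top r^2-E,\quad F_3=\log w+(1+\lambda)u+\mu r^2,\quad F_4=A^\top WAx-A^\top Wb.$$ $J(y)=\nabla_yF$ is the $(2+m+n)\times(2+m+n)$ Jacobian of $F$ with respect to $y$ (independent of $E$); at points where $F_4=0$ (in particular along the solution) it equals $$J(y)=\begin{pmatrix}0&0&u^\top&0^\top\\ 0&0&(r^2)^\top&0^\top\\ u&r^2&W^{-1}&2\mu\,\mathrm{diag}(r)A\\ 0&0&(\mathrm{diag}(r)A)^\top&A^\top WA\end{pmatrix}.$$ $e_2$ is the second standard basis vector of $\mathbb{R}^{2+m+n}$. The ordinary least squares critical point is $y^*=(-(1+\log\frac1m),\,0,\,\frac1m u^\top,\,(x^* )^\top)^\top$. The domain is $\mathcal D=\mathbb{R}\times\mathbb{R}\times\Delta_m^\circ\times\mathbb{R}^n$ with $\Delta_m^\circ=\{w\in\mathbb{R}^m: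 w_i>0\ \forall i,\ \sum_i w_i=1\}$; the right-hand side $J(y)^{-1}e_2$ is considered where $J(y)$ is invertible. The differential problem arises by differentiating $F(y(E);E)=0$ in $E$, and it is solved in the direction of decreasing $E$, only for positive values of $E$. *)

(* Defs.v *)
From mathcomp Require Import all_boot all_order all_algebra.
From mathcomp Require Import all_classical all_reals all_analysis.
Import Order.TTheory GRing.Theory Num.Theory.
Import numFieldNormedType.Exports.

Set Implicit Arguments.
Unset Strict Implicit.
Unset Printing Implicit Defensive.

Local Open Scope classical_set_scope.
Local Open Scope ring_scope.

(* States (lambda, mu, w^T, x^T) are stored as row vectors, so that the
   topology and the Jacobian of MathComp-Analysis apply; the components w, x
   and all the linear algebra are in column form. *)
Notation state R m n := 'rV[R]_(1 + 1 + m + n).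

Section Components.
Context {R : realType} {m n : nat}.

Definition mk_state (lambda mu : R) (w : 'cV[R]_m) (x : 'cV[R]_n) :
    state R m n :=
  row_mx (row_mx (row_mx lambda%:M mu%:M) w^T) x^T.

Definition lambda_of (y : state R m n) : R := lsubmx (lsubmx (lsubmx y)) 0 0.
Definition mu_of (y : state R m n) : R := rsubmx (lsubmx (lsubmx y)) 0 0.
Definition w_of (y : state R m n) : 'cV[R]_m := (rsubmx (lsubmx y))^T.
Definition x_of (y : state R m n) : 'cV[R]_n := (rsubmx y)^T.

Definition e2 : 'cV[R]_(1 + 1 + m + n) := (mk_state 0 1 0 0)^T.

(* R x R x (open probability simplex) x R^n *)
Definition domainD : set (state R m n) :=
  [set y | (forall i, 0 < w_of y i 0) /\ \sum_i w_of y i 0 = 1].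

End Components.

Definition sqr_mx {R : realType} {m : nat} (v : 'cV[R]_m) : 'cV[R]_m :=
  map_mx (fun t => t ^+ 2) v.

Definition log_mx {R : realType} {m : nat} (v : 'cV[R]_m) : 'cV[R]_m :=
  map_mx (@ln R) v.

Section System.
Context {R : realType} {m n : nat}.
Variables (A : 'M[R]_(m, n)) (b : 'cV[R]_m).

Definition xstar : 'cV[R]_n := invmx (A^T *m A) *m A^T *m b.
Definition rstar : 'cV[R]_m := A *m xstar - b.
Definition Euw : R := m%:R^-1 * \sum_i (rstar i 0) ^+ 2.

Definition ystar : state R m n :=
  mk_state (- (1 + ln (m%:R^-1))) 0 (const_mx m%:R^-1) xstar.

Definition Fsys (E : R) (y : state R m n) : state R m n :=
  let w := w_of y in
  let x := x_of y in
  let W := diag_mx w^T in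
  let r := A *m x - b in
  mk_state
    (\sum_i w i 0 - 1)
    ((w^T *m sqr_mx r) 0 0 - E)
    (log_mx w + const_mx (1 + lambda_of y) + mu_of y *: sqr_mx r)
    (A^T *m W *m A *m x - A^T *m W *m b).

(* The entry (i, j) is the partial derivative of F_i with respect to y_j: the
   library Jacobian acts on row vectors from the right, whence the transpose.
   E enters Fsys only as an additive constant, so that its value is
   irrelevant here. *)
Definition Jsys (y : state R m n) : 'M[R]_(1 + 1 + m + n) :=
  ('J (Fsys 0) y)^T.

(* The derivative is taken relative to ]E0, Euw]: it is the usual derivative
   at interior points and the left derivative at Euw. Since invmx is total,
   invertibility of the Jacobian is required explicitly. *)
Definition solution_on (E0 : R) (y : R -> state R m n) : Prop :=
  y Euw = ystar /\
  forall E, E0 < E <= Euw ->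
    [/\ domainD (y E),
        Jsys (y E) \in unitmx &
        (z - E)^-1 *: (y z - y E) @[z --> within [set` `]E0, Euw]] E^']
          --> (invmx (Jsys (y E)) *m e2)^T].

(* Only positive values of E are considered, whence 0 <= E0. *)
Definition maximal_solution (Emin : R) (y : R -> state R m n) : Prop :=
  [/\ 0 <= Emin, Emin < Euw, solution_on Emin y &
      ~ exists E0 z, [/\ 0 <= E0, E0 < Emin, solution_on E0 z &
                         forall E, Emin < E <= Euw -> z E = y E]].

Definition finite_breakdown (Emin : R) : Prop :=
  0 < Emin /\
  forall E0 z, 0 <= E0 -> E0 < Emin -> ~ solution_on E0 z.

Definition extension_to_zero (Emin : R) (y : R -> state R m n) : Prop :=
  [/\ Emin = 0, solution_on 0 y &
      forall z, solution_on 0 z -> forall E, 0 < E <= Euw -> z E = y E].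

Definition remains_bounded (Emin : R) (y : R -> state R m n) : Prop :=
  exists M : R, forall E, Emin < E <= Euw -> `|y E| <= M.

(* The library norm on row vectors is the sup norm, which is equivalent to the
   Euclidean one. *)
Definition escapes_to_infinity (Emin : R) (y : R -> state R m n) : Prop :=
  `|y E| @[E --> Emin^'+] --> +oo.

Definition approaches_boundary (Emin : R) (y : R -> state R m n) : Prop :=
  remains_bounded Emin y /\
  exists i : 'I_m, w_of (y E) i 0 @[E --> Emin^'+] --> (0 : R).

(* "Inside the domain" is meant uniformly: the weights stay away from 0, hence
   y(E) stays in a compact subset of the domain. *)
Definition becomes_singular (Emin : R) (y : R -> state R m n) : Prop :=
  [/\ remains_bounded Emin y,
      exists2 d : R, 0 < d &
        forall E i, Emin < E <= Euw -> d <= w_of (y E) i 0 &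
      \det (Jsys (y E)) @[E --> Emin^'+] --> (0 : R)].

End System.

(* Main.v *)
From HB Require Import structures.
Require Import Defs.
From mathcomp Require Import all_boot all_order all_algebra.
From mathcomp Require Import all_classical all_reals all_analysis.
From mathcomp Require Import ring lra.
Import Order.TTheory GRing.Theory Num.Theory.
Import numFieldNormedType.Exports.

(** Idea of the proof.

    The problem y' = J(y)^-1 e_2 is the differentiated form of F(y; E) = 0, so
    that a solution on ]E0, Euw] is the same thing as a continuous branch of
    F(y; 0) = E e_2 through states with positive weights and invertible J
    (solution_onP).  Since F is strictly differentiable, F(.; 0) has a local
    inverse at such states (local_inverse).  Uniqueness (branch_unique), the
    existence of a maximal branch (maximal_branch_exists) and the continuation
    of a branch through any regular state at which it accumulates
    (branch_extend) follow, as for an ordinary Picard-Lindeloef flow.  At y^* the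
    Jacobian is invertible because |r^*| is not constant
    (jacobian_ystar_unit), which starts the process.

    This general theory only says that at a breakdown point Emin > 0 the curve
    leaves every compact set of regular states; it could still oscillate
    between a bounded region and infinity.  The core of the proof excludes
    that.  On the curve the weights are Gibbs weights
    w_i = exp (h - mu (r_i^2 - E)), where h = sum_i w_i ln w_i lies in
    [- ln m, 0], and x solves a weighted least squares problem with positive
    weights, which confines it to a fixed ball whatever the weights are
    (stationary_bounded).  So mu alone controls the size of y.  The envelope
    identity h' = - mu holds along the curve (curve_entropy_derive); as h is
    minimal at Euw, it forces mu > 0 (curve_mu_gt0), hence h is monotone and
    has a limit h0 at Emin.

    Suppose that mu neither tends to +oo nor is bounded.  Then every large
    value k of mu is attained arbitrarily close to Emin (mu_oscillation), and a
    cluster point there yields a critical state with multiplier exactly k, loss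
    exactly Emin and negative entropy exactly h0, for every large k.  Such a
    ray of critical states cannot exist (no_critical_ray).  Let rho and om be
    limits of its residuals and weights as k grows.  Stationarity turns the
    quadratic expansion of r_i^2 around rho_i into exact identities:
      sum_i w_i (rho_i^2 - E)  = sum_i w_i (r_i - rho_i)^2,
      sum_i om_i (r_i^2 - E)   = sum_i om_i (r_i - rho_i)^2.
    The left side of the first one is exponentially small in k, which leaves om
    uniform on its support.  In the second one, multiplied by k, the left
    side is minus the first moment of the exponents sg_i = - k (r_i^2 - E) and
    the right side is O(1/k) times their second moment; as the exp sg_i
    average to at most 1 on the support, strict convexity of exp makes every
    sg_i vanish.  The weights are then uniform, x = x^*, and |r^*| is constant,
    which was excluded.

    Hence either mu tends to +oo, and y escapes to infinity (escape_of_mu), or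
    mu is bounded, y stays in a compact part of the domain, and det J must tend
    to 0 because a regular cluster point would allow an extension
    (curve_singular).

    Limits along subsequences are taken along ultrafilters, for which every
    bounded real function converges (ultra_cvg_real). *)

Local Open Scope classical_set_scope.
Local Open Scope ring_scope.

(** * Norms of matrices *)

Lemma mx_coord_le (R : realType) (k l : nat) (M : 'M[R]_(k, l)) i j :
  `|M i j| <= `|M|.
Proof.
rewrite [leRHS]/Num.norm /= mx_normrE.
exact: (le_bigmax _ (fun ij : 'I_k * 'I_l => `|M ij.1 ij.2|) (i, j)).
Qed.

Lemma mx_norm_le (R : realType) (k l : nat) (M : 'M[R]_(k, l)) (c : R) :
  0 <= c -> (forall i j, `|M i j| <= c) -> `|M| <= c.
Proof.
move=> c0 h; rewrite [leLHS]/Num.norm /= mx_normrE.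
by apply: bigmax_le => // -[i j] _; exact: h.
Qed.

Lemma norm_mulmx_le (R : realType) (k l p : nat) (M : 'M[R]_(k, l))
  (L : 'M[R]_(l, p)) : `|M *m L| <= l%:R * `|L| * `|M|.
Proof.
apply: mx_norm_le => [|i j]; first by rewrite !mulr_ge0.
rewrite mxE (le_trans (ler_norm_sum _ _ _)) //.
rewrite (le_trans (y := \sum_(s < l) `|L| * `|M|)) //.
  apply: ler_sum => s _; rewrite normrM mulrC.
  by apply: ler_pM => //; exact: mx_coord_le.
by rewrite sumr_const card_ord -mulrA mulr_natl.
Qed.

Lemma near_dist_lt (R : realType) (V : normedModType R) (p : V) (e : R) :
  0 < e -> \forall y \near p, `|y - p| < e.
Proof.
move=> e0; apply/nbhs_ballP; exists e => //= y.
by rewrite -ball_normE /= distrC.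
Qed.

(** * Strict differentiability *)

Section StrictDifferentiability.
Context {R : realType} {V W : normedModType R}.

(** Two-point form of differentiability.  On an open set it amounts to the C^1
    property, but it asks for no norm on differentials and says directly that
    f is close to an affine map near p, which is what local inversion uses. *)
Definition strict_diff (f : V -> W) (p : V) (df : V -> W) : Prop :=
  forall e, 0 < e -> \forall yz \near (p, p),
    `|f yz.1 - f yz.2 - df (yz.1 - yz.2)| <= e * `|yz.1 - yz.2|.

Lemma strict_diff_near1 (f : V -> W) p df :
  strict_diff f p df -> forall e, 0 < e -> \forall y \near p,
    `|f y - f p - df (y - p)| <= e * `|y - p|.
Proof.
move=> fL e e0; have [[A B] [/= pA pB] AB] := fL e e0.
apply: filterS pA => y Ay; apply: (AB (y, p)); split => //=.
exact: nbhs_singleton.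
Qed.

Lemma strict_diff_lipschitz (f : V -> W) p df k :
  strict_diff f p df -> (forall v, `|df v| <= k * `|v|) ->
  \forall yz \near (p, p), `|f yz.1 - f yz.2| <= (1 + k) * `|yz.1 - yz.2|.
Proof.
move=> /(_ 1 ltr01) fL dfk.
apply: filterS fL => -[y z] /= h.
rewrite -(subrK (df (y - z)) (f y - f z)) (le_trans (ler_normD _ _)) //.
by rewrite mulrDl lerD.
Qed.

Lemma strict_diff_cvg (f : V -> W) p df k :
  strict_diff f p df -> (forall v, `|df v| <= k * `|v|) -> f y @[y --> p] --> f p.
Proof.
move=> /strict_diff_lipschitz h /h [[A B] [/= pA pB] AB].
apply/cvgrPdist_le => e e0.
have K0 : 0 < 1 + `|k| by rewrite ltr_pwDl.
have d0 : 0 < (1 + `|k|)^-1 * e by rewrite mulr_gt0 ?invr_gt0.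
apply: filterS2 pA (near_dist_lt _ _ p _ d0) => y Ay yp.
rewrite distrC (le_trans (AB (y, p) _)) //=.
  by split => //=; exact: nbhs_singleton.
rewrite (le_trans (y := (1 + `|k|) * `|y - p|)) ?ler_wpM2r ?lerD2l ?ler_norm //.
by rewrite -ler_pdivlMl // ltW.
Qed.

Lemma strict_diff_diff (f : V -> W) p (df : {linear V -> W}) k :
  strict_diff f p df -> (forall v, `|df v| <= k * `|v|) ->
  'd f p = df :> (V -> W).
Proof.
move=> fL dfk; apply: diff_unique.
  move=> q; apply: (strict_diff_cvg df q df k) => // e e0.
  by apply: (@nearW _ (nbhs (q, q))) => -[y z] /=; rewrite -linearB subrr normr0 mulr_ge0 // ltW.
apply/eqaddoP => e e0.
have := strict_diff_near1 _ _ _ fL _ e0.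
rewrite (near_shift 0) => H; apply: (@filterS _ (nbhs 0) _ _ _ _ H) => h /=.
by rewrite subr0 addrK !fctE /= opprD addrA.
Qed.

End StrictDifferentiability.

Section StrictDifferentiabilityMatrix.
Context {R : realType}.

Lemma mulmxr_bound {N M : nat} (L : 'M[R]_(N, M)) (v : 'rV[R]_N) :
  `|mulmxr L v| <= N%:R * `|L| * `|v|.
Proof. exact: norm_mulmx_le. Qed.

Lemma strict_diff_jacobian N M (f : 'rV[R]_N -> 'rV[R]_M) p (L : 'M[R]_(N, M)) :
  strict_diff f p (mulmxr L) -> 'J f p = L.
Proof.
move=> fL.
have dE := strict_diff_diff f p (mulmxr L) _ fL (mulmxr_bound L).
rewrite /jacobian; apply/row_matrixP => i.
by rewrite !rowE mul_rV_lin1 /= dE.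
Qed.

Lemma strict_diff_coord N M (f : 'rV[R]_N -> 'rV[R]_M) p (L : 'M[R]_(N, M)) :
  (forall j, strict_diff (fun y => f y 0 j) p (fun v => (v *m L) 0 j)) ->
  strict_diff f p (mulmxr L).
Proof.
move=> h e e0.
have : \forall yz \near (p, p), forall j, 
   `|f yz.1 0 j - f yz.2 0 j - ((yz.1 - yz.2) *m L) 0 j| <= e * `|yz.1 - yz.2|.
  by apply: (@filter_forall _ _ _ (nbhs (p, p))) => j; exact: h.
apply: filterS => -[y z] /= H; apply: mx_norm_le; first by rewrite mulr_ge0 // ltW.
by move=> i j; rewrite ord1; have := H j; rewrite !mxE.
Qed.

End StrictDifferentiabilityMatrix.

(** * Limits of determinants and local inversion *)

Lemma cvg_sumR {R : realType} {T : Type} (F : set_system T) (FF : Filter F)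
    (I : finType) (P : pred I) (u : I -> T -> R) (l : I -> R) :
  (forall i, P i -> u i x @[x --> F] --> l i) ->
  \sum_(i | P i) u i x @[x --> F] --> \sum_(i | P i) l i.
Proof.
by move=> h; apply: cvg_big => //; exact: add_continuous.
Qed.

Lemma cvg_prodR {R : realType} {T : Type} (F : set_system T) (FF : Filter F)
    (I : finType) (P : pred I) (u : I -> T -> R) (l : I -> R) :
  (forall i, P i -> u i x @[x --> F] --> l i) ->
  \prod_(i | P i) u i x @[x --> F] --> \prod_(i | P i) l i.
Proof.
by move=> h; apply: cvg_big => //; exact: mul_continuous.
Qed.

Lemma cvg_det {R : realType} {T : Type} (F : set_system T) (FF : Filter F)
    (N : nat) (M : T -> 'M[R]_N) (L : 'M[R]_N) :
  (forall i j, M x i j @[x --> F] --> L i j) ->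
  \det (M x) @[x --> F] --> \det L.
Proof.
move=> h; apply: cvg_sumR => s _; apply: cvgM; first exact: cvg_cst.
by apply: cvg_prodR => i _; exact: h.
Qed.

Lemma near_pair_ball {R : realType} {V : normedModType R} (p : V) (P : V * V -> Prop) :
  (\forall yz \near (p, p), P yz) <->
  exists2 d, 0 < d & forall y z, `|y - p| < d -> `|z - p| < d -> P (y, z).
Proof.
split => [[[A B] [/= /nbhs_ballP[a a0 pA] /nbhs_ballP[b b0 pB]] AB]|[d d0 h]].
  exists (Num.min a b) => [|y z yp zp]; first by rewrite lt_min a0.
  apply: (AB (y, z)); split => /=; [apply: pA|apply: pB].
    by rewrite -ball_normE /= distrC (lt_le_trans yp) // ge_min lexx.
  by rewrite -ball_normE /= distrC (lt_le_trans zp) // ge_min lexx orbT.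
exists ([set y | `|y - p| < d], [set y | `|y - p| < d]).
  by split; exact: near_dist_lt.
by move=> [y z] [/= yp zp]; exact: h.
Qed.

Lemma strict_diffP {R : realType} {V W : normedModType R} (f : V -> W) p df :
  strict_diff f p df <->
  forall e, 0 < e -> exists2 d, 0 < d & forall y z, `|y - p| < d -> `|z - p| < d ->
    `|f y - f z - df (y - z)| <= e * `|y - z|.
Proof.
by split => h e /h; rewrite (near_pair_ball p (fun yz => _ <= e * `|yz.1 - yz.2|)).
Qed.

Section LocalInverse.
Context {R : realType} {N : nat}.
Implicit Types (f : 'rV[R]_N -> 'rV[R]_N) (p : 'rV[R]_N) (L : 'M[R]_N).

(** Near p the map f differs from its differential L by a small multiple of
    the distance, hence it is injective with Lipschitz inverse.  For
    surjectivity, the norm of f y - v is minimized on a small closed ball: one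
    Newton step from a minimizer would at least halve it, unless it is zero. *)
Lemma local_inverse f p L : strict_diff f p (mulmxr L) -> L \in unitmx ->
  exists K d0, [/\ 0 < K, 0 < d0,
    forall y z, `|y - p| < d0 -> `|z - p| < d0 -> `|y - z| <= K * `|f y - f z| &
    forall d, 0 < d -> exists2 e, 0 < e &
      forall v, `|v - f p| < e -> exists2 y, `|y - p| < d & f y = v].
Proof.
move=> fL Lu.
pose C := 1 + N%:R * `|invmx L|.
have C0 : 0 < C by rewrite ltr_pwDl // mulr_ge0.
have hC (v : 'rV[R]_N) : `|v *m invmx L| <= C * `|v|.
  by rewrite (le_trans (norm_mulmx_le _ _ _ _ _ _)) // ler_wpM2r // lerDr.
have e0 : 0 < (2 * C)^-1 by rewrite invr_gt0 mulr_gt0.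
have [d0 d00 hd] := (strict_diffP _ _ _).1 fL _ e0.
have inj y z : `|y - p| < d0 -> `|z - p| < d0 -> `|y - z| <= 2 * C * `|f y - f z|.
  move=> yp zp; have := hd _ _ yp zp; set u := y - z; set g := f y - f z => h.
  have : `|u| <= C * (`|g| + (2 * C)^-1 * `|u|).
    rewrite -{1}(mulmxK Lu u) (le_trans (hC _)) // ler_pM2l //.
    rewrite -{1}(subKr g (u *m L)) (le_trans (ler_normB _ _)) // lerD2l.
    exact: h.
  rewrite mulrDr mulrA invfM mulrCA mulfV ?gt_eqF // mulr1 => h2.
  by rewrite -mulrA; lra.
exists (2 * C), d0; split => //; first by rewrite mulr_gt0.
move=> d dpos.
(* v within r / (8 C) of f p keeps the minimizer y0 within r / 2 of p, and the
   Newton step from y0, of length at most r / 8, inside the ball. *)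
pose r := Num.min d d0 / 2.
have r0 : 0 < r by rewrite divr_gt0 // lt_min dpos.
have rd : r < d.
  rewrite ltr_pdivrMr // (le_lt_trans (y := d)) ?ge_min ?lexx //.
  by rewrite mulr_natr mulr2n ltrDl.
have rd0 : r < d0.
  rewrite ltr_pdivrMr // (le_lt_trans (y := d0)) ?ge_min ?lexx ?orbT //.
  by rewrite mulr_natr mulr2n ltrDl.
have Cn0 : C != 0 by rewrite gt_eqF.
exists (r / (8 * C)); first by rewrite divr_gt0 // mulr_gt0.
move=> v hv.
pose B := [set y : 'rV[R]_N | `|y - p| <= r].
have Bd y : B y -> `|y - p| < d0 by move=> /le_lt_trans; apply.
have [] := @EVT_min_rV R N (fun y => `|f y - v|) B.
- by exists p; rewrite /B /= subrr normr0 ltW.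
- apply: bounded_closed_compact.
    exists (`|p| + r); split; first by rewrite num_real.
    move=> M hM y By; apply: le_trans (ltW hM); rewrite -(subrK p y).
    by rewrite addrC (le_trans (ler_normD _ _)) // lerD2l.
  have -> : B = closed_ball p r.
    by rewrite closed_ballE // /closed_ball_; apply/seteqP; split => y /=; rewrite distrC.
  exact: closed_ball_closed.
- apply: continuous_in_subspaceT => y /set_mem /Bd yp.
  pose k := (2 * C)^-1 + N%:R * `|L|.
  have k0 : 0 < k by rewrite ltr_pwDl // mulr_ge0.
  apply/(@cvgrPdist_le _ _ _ (nbhs y)) => e epos.
  have s0 : 0 < Num.min (d0 - `|y - p|) (k^-1 * e).
    by rewrite lt_min subr_gt0 yp mulr_gt0 // invr_gt0.
  apply: (@filterS _ (nbhs y) _ _ _ _ (near_dist_lt R 'rV[R]_N y _ s0)) => z.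
  rewrite lt_min => /andP[zy1 zy2].
  have zp : `|z - p| < d0.
    rewrite -(subrK y z) -addrA (le_lt_trans (ler_normD _ _)) //.
    by rewrite -ltrBrDr.
  rewrite (le_trans (ler_dist_dist _ _)) // opprB addrA subrK.
  apply: (le_trans (y := k * `|y - z|)).
    rewrite -(subrK ((y - z) *m L) (f y - f z)) (le_trans (ler_normD _ _)) //.
    rewrite mulrDl lerD //; first exact: hd.
    exact: norm_mulmx_le.
  by rewrite -ler_pdivlMl // distrC ltW.
move=> y0 /set_mem By0 miny0.
have y0v : `|f y0 - v| < r / (8 * C).
  apply: le_lt_trans hv; rewrite [leRHS]distrC; apply: miny0.
  by rewrite inE /B /= subrr normr0 ltW.
have y0p : `|y0 - p| < r / 2.
  have := inj _ _ (Bd _ By0) (_ : `|p - p| < d0).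
  rewrite subrr normr0 => /(_ d00) h; apply: (le_lt_trans h).
  have : `|f y0 - f p| < r / (8 * C) + r / (8 * C).
    rewrite -(subrK v (f y0)) -addrA (le_lt_trans (ler_normD _ _)) // ltrD //.
  rewrite -(ltr_pM2l (_ : 0 < 2 * C)) ?mulr_gt0 // => h2; apply: (lt_le_trans h2).
  rewrite le_eqVlt; apply/orP; left; apply/eqP; field; exact: Cn0.
exists y0; first exact: le_lt_trans By0 rd.
apply/eqP; rewrite -subr_eq0 -normr_le0 leNgt; apply/negP => pos.
pose y1 := y0 + (v - f y0) *m invmx L.
have hy1 : y1 - y0 = (v - f y0) *m invmx L by rewrite /y1 [y0 + _]addrC addrK.
have y10 : `|y1 - y0| <= C * `|f y0 - v|.
  by rewrite hy1 (distrC (f y0) v); exact: hC.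
have By1 : B y1.
  rewrite /B /= -(subrK y0 y1) -addrA (le_trans (ler_normD _ _)) //.
  have : C * `|f y0 - v| < r / 8.
    rewrite -(ltr_pM2l C0) in y0v; apply: (lt_le_trans y0v).
    rewrite le_eqVlt; apply/orP; left; apply/eqP; field; exact: Cn0.
  by lra.
have := miny0 y1; rewrite inE => /(_ By1); apply/negP; rewrite -ltNge.
have := hd _ _ (Bd _ By1) (Bd _ By0).
rewrite {1}hy1 /= mulmxKV //.
have -> : f y1 - f y0 - (v - f y0) = f y1 - v.
  by rewrite opprB addrA subrK.
move=> /le_lt_trans; apply.
have : (2 * C)^-1 * `|y1 - y0| <= (2 * C)^-1 * (C * `|f y0 - v|) by rewrite ler_pM2l.
move=> /le_lt_trans; apply.
by rewrite invfM -mulrA mulKf //; lra.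
Qed.

End LocalInverse.

(** * Rules of strict differentiation *)

(** The estimate of f near p with a fixed error applies to increments based
    at any q close to p; there it competes with the estimate at q, so the two
    differentials agree up to that error on small increments, and by
    homogeneity on all. *)
Lemma strict_diff_matrix_cvg {R : realType} {N M : nat}
    (f : 'rV[R]_N -> 'rV[R]_M) (L : 'rV[R]_N -> 'M[R]_(N, M)) (p : 'rV[R]_N) :
  (\forall q \near p, strict_diff f q (mulmxr (L q))) ->
  forall i j, L q i j @[q --> p] --> L p i j.
Proof.
move=> near_sd i j; have sdp := nbhs_singleton near_sd.
apply/(@cvgrPdist_le _ _ _ (nbhs p)) => e e0.
have h0 : 0 < e / 2 by rewrite divr_gt0.
have [d d0 hd] := (strict_diffP _ _ _).1 sdp _ h0.
apply: (@filterS2 _ (nbhs p) _ _ _ _ _ near_sd (near_dist_lt R 'rV[R]_N p _ d0)).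
move=> q sdq qp; have [c c0 hc] := (strict_diffP _ _ _).1 sdq _ h0.
pose t := Num.min (d - `|q - p|) c / 2.
have m0 : 0 < Num.min (d - `|q - p|) c by rewrite lt_min subr_gt0 qp.
have t0 : 0 < t by rewrite divr_gt0.
have tm : t < Num.min (d - `|q - p|) c by rewrite ltr_pdivrMr // mulr_natr mulr2n ltrDl.
move: tm; rewrite lt_min => /andP[td tc].
pose v : 'rV[R]_N := t *: delta_mx 0 i.
have vt : `|v| <= t.
  apply: mx_norm_le => [|a b]; first exact: ltW.
  rewrite !mxE normrM (gtr0_norm t0) ler_piMr ?(ltW t0) //.
  by case: (_ && _); rewrite ?normr1 ?normr0.
have vE : q + v - q = v by rewrite addrC addKr.
have h1 : `|f (q + v) - f q - v *m L p| <= e / 2 * `|v|.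
  rewrite -{2 3}vE; apply: hd => //.
  by rewrite addrAC (le_lt_trans (ler_normD _ _)) // -ltrBrDl (le_lt_trans vt).
have h2 : `|f (q + v) - f q - v *m L q| <= e / 2 * `|v|.
  by rewrite -{2 3}vE; apply: hc => //; rewrite ?vE ?subrr ?normr0 // (le_lt_trans vt).
have h3 : `|v *m (L p - L q)| <= e * t.
  have -> : v *m (L p - L q) =
      (f (q + v) - f q - v *m L q) - (f (q + v) - f q - v *m L p).
    by rewrite mulmxBr opprB [RHS]addrC addrA subrK.
  rewrite (le_trans (ler_normB _ _)) // (le_trans (lerD h2 h1)) //.
  by rewrite -mulrDl -splitr ler_pM2l.
have := le_trans (mx_coord_le _ _ _ _ 0 j) h3.
rewrite -scalemxAl mxE -rowE !mxE normrM (gtr0_norm t0) [e * t]mulrC.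
by rewrite ler_pM2l.
Qed.

Section ScalarRules.
Context {R : realType} {V : normedModType R}.
Implicit Types (f g : V -> R) (p : V).

(** The bound on the differential gives continuity of f at p, which the
    product rule and the rule for the logarithm rely on. *)
Definition sdiff f p (df : V -> R) : Prop :=
  strict_diff f p df /\ exists2 k, 0 < k & forall v, `|df v| <= k * `|v|.

Lemma sdiff_cst c p : sdiff (fun=> c) p (fun=> 0).
Proof.
split; last by exists 1 => // v; rewrite normr0 mul1r.
move=> e e0; apply: (@nearW _ (nbhs (p, p))) => yz.
by rewrite !subrr normr0 mulr_ge0 // ltW.
Qed.

Lemma sdiffD f g p df dg : sdiff f p df -> sdiff g p dg ->
  sdiff (fun y => f y + g y) p (fun v => df v + dg v).
Proof.
move=> [fd [k k0 fk]] [gd [l l0 gl]]; split; last first.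
  exists (k + l) => [|v]; first exact: addr_gt0.
  by rewrite (le_trans (ler_normD _ _)) // mulrDl lerD.
move=> e e0; have h0 : 0 < e / 2 by rewrite divr_gt0.
apply: (@filterS2 _ (nbhs (p, p)) _ _ _ _ _ (fd _ h0) (gd _ h0)) => -[y z] /= h1 h2.
rewrite [e]splitr mulrDl.
have -> : f y + g y - (f z + g z) - (df (y - z) + dg (y - z)) =
  (f y - f z - df (y - z)) + (g y - g z - dg (y - z)) by ring.
by rewrite (le_trans (ler_normD _ _)) // lerD.
Qed.

Lemma sdiffM f g p df dg : sdiff f p df -> sdiff g p dg ->
  sdiff (fun y => f y * g y) p (fun v => f p * dg v + g p * df v).
Proof.
move=> [fd [k k0 fk]] [gd [l l0 gl]]; split; last first.
  exists (`|f p| * l + `|g p| * k + 1) => [|v].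
    by rewrite ltr_wpDl // addr_ge0 // mulr_ge0 // ltW.
  rewrite (le_trans (ler_normD _ _)) // !normrM 2!mulrDl -!mulrA mul1r.
  rewrite (le_trans (y := `|f p| * (l * `|v|) + `|g p| * (k * `|v|))) ?lerDl //.
  by rewrite lerD // ler_wpM2l.
have fc : f y @[y --> p] --> f p by apply: strict_diff_cvg fd fk.
have gc : g y @[y --> p] --> g p by apply: strict_diff_cvg gd gl.
move=> e e0.
pose c := `|f p| + `|g p| + k + l + 1.
have c0 : 0 < c by rewrite ltr_wpDl // !addr_ge0 // ltW.
pose e' := Num.min 1 (e / (4 * c)).
have e'0 : 0 < e' by rewrite lt_min ltr01 divr_gt0 // mulr_gt0.
have e'1 : e' <= 1 by rewrite ge_min lexx.
have e'c : e' * c <= e / 4.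
  have : e' <= e / (4 * c) by rewrite ge_min lexx orbT.
  by rewrite -(ler_pM2r c0) => /le_trans; apply; rewrite invfM mulrA mulfVK // gt_eqF.
have near_f : \forall y \near p, `|f p - f y| <= e' by move/cvgrPdist_le : fc; apply.
have near_g : \forall y \near p, `|g p - g y| <= e' by move/cvgrPdist_le : gc; apply.
have near_fg : \forall yz \near (p, p), `|f p - f yz.1| <= e' /\ `|g p - g yz.2| <= e'.
  exists ([set y | `|f p - f y| <= e'], [set y | `|g p - g y| <= e']); first by split.
  by move=> [y z].
apply: (@filterS3 _ (nbhs (p, p)) _ _ _ _ _ _ near_fg (fd _ e'0) (gd _ e'0)).
move=> [y z] /= [fy gz] hf hg.
set u := `|y - z|; have u0 : 0 <= u by rewrite normr_ge0.
have -> : f y * g y - f z * g z - (f p * dg (y - z) + g p * df (y - z)) =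
  f y * (g y - g z - dg (y - z)) + (f y - f p) * dg (y - z)
  + g z * (f y - f z - df (y - z)) + (g z - g p) * df (y - z) by ring.
have bf : `|f y| <= c.
  rewrite -(subrK (f p) (f y)) (le_trans (ler_normD _ _)) // distrC.
  rewrite /c; have := normr_ge0 (g p); lra.
have bg : `|g z| <= c.
  rewrite -(subrK (g p) (g z)) (le_trans (ler_normD _ _)) // distrC.
  rewrite /c; have := normr_ge0 (f p); lra.
have b1 : `|f y * (g y - g z - dg (y - z))| <= e / 4 * u.
  rewrite normrM (le_trans (ler_pM _ _ bf hg)) // mulrCA mulrA.
  by rewrite ler_wpM2r // mulrC.
have b2 : `|(f y - f p) * dg (y - z)| <= e / 4 * u.
  rewrite normrM distrC (le_trans (ler_pM _ _ fy (gl _))) // mulrA ler_wpM2r //.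
  apply: le_trans e'c; rewrite ler_pM2l // /c.
  by have := normr_ge0 (f p); have := normr_ge0 (g p); lra.
have b3 : `|g z * (f y - f z - df (y - z))| <= e / 4 * u.
  rewrite normrM (le_trans (ler_pM _ _ bg hf)) // mulrCA mulrA.
  by rewrite ler_wpM2r // mulrC.
have b4 : `|(g z - g p) * df (y - z)| <= e / 4 * u.
  rewrite normrM distrC (le_trans (ler_pM _ _ gz (fk _))) // mulrA ler_wpM2r //.
  apply: le_trans e'c; rewrite ler_pM2l // /c.
  by have := normr_ge0 (f p); have := normr_ge0 (g p); lra.
rewrite (le_trans (ler_normD _ _)) //.
rewrite (le_trans (lerD (ler_normD _ _) b4)) //.
rewrite (le_trans (lerD (lerD (ler_normD _ _) b3) (lexx _))) //.
rewrite (le_trans (lerD (lerD (lerD b1 b2) (lexx _)) (lexx _))) //.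
by rewrite le_eqVlt; apply/orP; left; apply/eqP; field.
Qed.

Lemma sdiff_sum (I : finType) (f : I -> V -> R) p (df : I -> V -> R) :
  (forall i, sdiff (f i) p (df i)) ->
  sdiff (fun y => \sum_i f i y) p (fun v => \sum_i df i v).
Proof.
move=> h.
have : forall r : seq I, sdiff (fun y => \sum_(i <- r) f i y) p (fun v => \sum_(i <- r) df i v).
  elim => [|i r IH].
    have -> : (fun y => \sum_(i <- [::]) f i y) = (fun=> 0).
      by apply/funext => y; rewrite big_nil.
    have -> : (fun y => \sum_(i <- [::]) df i y) = (fun=> 0).
      by apply/funext => y; rewrite big_nil.
    exact: sdiff_cst.
  have -> : (fun y => \sum_(i <- i :: r) f i y) = (fun y => f i y + \sum_(i <- r) f i y).
    by apply/funext => y; rewrite big_cons.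
  have -> : (fun y => \sum_(i <- i :: r) df i y) = (fun y => df i y + \sum_(i <- r) df i y).
    by apply/funext => y; rewrite big_cons.
  exact: sdiffD.
by move/(_ (index_enum I)).
Qed.

Lemma ln_diff_bounds (a b : R) : 0 < a -> 0 < b ->
  (a - b) / a <= ln a - ln b <= (a - b) / b.
Proof.
move=> a0 b0.
have key (x y : R) : 0 < x -> 0 < y -> ln x - ln y <= (x - y) / y.
  move=> x0 y0; rewrite -ln_div ?posrE //.
  have -> : x / y = 1 + (x - y) / y by rewrite mulrBl mulfV ?gt_eqF // addrC subrK.
  by apply: le_ln1Dx; rewrite -subr_gt0 opprK addrC mulrBl mulfV ?gt_eqF // addrC subrK divr_gt0.
rewrite key // andbT -lerN2 opprB -mulNr opprB; exact: key.
Qed.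

(** The slope of ln between f y and f z lies between the inverses of the two
    values, both of which are close to the inverse of f p. *)
Lemma sdiff_ln f p df : 0 < f p -> sdiff f p df ->
  sdiff (fun y => ln (f y)) p (fun v => df v / f p).
Proof.
move=> fp0 [fd [k k0 fk]]; split; last first.
  exists (k / f p) => [|v]; first exact: divr_gt0.
  by rewrite normrM normfV (gtr0_norm fp0) mulrAC ler_pM2r ?invr_gt0.
have fc : f y @[y --> p] --> f p by apply: strict_diff_cvg fd fk.
have ic : (f y)^-1 @[y --> p] --> (f p)^-1 by apply: cvgV => //; rewrite gt_eqF.
move=> e e0.
pose c := (1 + k + (f p)^-1).
have c0 : 0 < c by rewrite addr_gt0 ?invr_gt0 // addr_gt0.
pose e' := e / (2 * c).
have e'0 : 0 < e' by rewrite divr_gt0 // mulr_gt0.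
have near_i : \forall y \near p, `|(f p)^-1 - (f y)^-1| <= e' /\ 0 < f y.
  have h1 : \forall y \near p, `|(f p)^-1 - (f y)^-1| <= e'.
    by move/cvgrPdist_le : ic; apply.
  have h2 : \forall y \near p, 0 < f y by apply: (cvgr_gt (f p)).
  by apply: filterS2 h1 h2.
have near_ii : \forall yz \near (p, p),
   (`|(f p)^-1 - (f yz.1)^-1| <= e' /\ 0 < f yz.1) /\
   (`|(f p)^-1 - (f yz.2)^-1| <= e' /\ 0 < f yz.2).
  exists ([set y | `|(f p)^-1 - (f y)^-1| <= e' /\ 0 < f y],
          [set y | `|(f p)^-1 - (f y)^-1| <= e' /\ 0 < f y]); first by split.
  by move=> [y z].
have lip := strict_diff_lipschitz _ _ _ _ fd fk.
apply: (@filterS3 _ (nbhs (p, p)) _ _ _ _ _ _ near_ii lip (fd _ e'0)).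
move=> [y z] /= [[iy y0] [iz z0]] fl hf.
set u := `|y - z| in fl hf *; have u0 : 0 <= u by rewrite normr_ge0.
have b1 : `|ln (f y) - ln (f z) - (f y - f z) / f p| <= e' * `|f y - f z|.
  have /andP[l1 l2] := ln_diff_bounds _ _ y0 z0.
  have B (i : R) : `|(f p)^-1 - i| <= e' ->
      `|(f y - f z) * i - (f y - f z) / f p| <= e' * `|f y - f z|.
    by move=> ie; rewrite -mulrBr normrM mulrC distrC ler_wpM2r.
  move: (B _ iy) (B _ iz); rewrite !ler_norml => /andP[p1 p2] /andP[p3 p4].
  by apply/andP; split; lra.
have -> : ln (f y) - ln (f z) - df (y - z) / f p =
   (ln (f y) - ln (f z) - (f y - f z) / f p)
   + (f y - f z - df (y - z)) / f p by rewrite [in RHS]mulrBl; ring.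
rewrite (le_trans (ler_normD _ _)) // (le_trans (lerD b1 (lexx _))) //.
rewrite normrM normfV (gtr0_norm fp0).
have b2 : e' * `|f y - f z| <= e' * (1 + k) * u by rewrite -mulrA ler_pM2l.
have b3 : `|f y - f z - df (y - z)| / f p <= e' * (f p)^-1 * u.
  by rewrite mulrAC ler_pM2r ?invr_gt0.
rewrite (le_trans (lerD b2 b3)) // -mulrDl -mulrDr -/c ler_wpM2r //.
rewrite /e' invfM mulrA mulfVK ?gt_eqF //; lra.
Qed.

End ScalarRules.

Lemma sdiff_coord {R : realType} {N : nat} (p : 'rV[R]_N) j :
  sdiff (fun y : 'rV[R]_N => y 0 j) p (fun v => v 0 j).
Proof.
split; last by exists 1 => // v; rewrite mul1r; exact: mx_coord_le.
move=> e e0; apply: (@nearW _ (nbhs (p, p))) => yz.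
by rewrite !mxE subrr normr0 mulr_ge0 // ltW.
Qed.

(** * Limits and increments on half-open intervals *)

Lemma near_itv_oc {R : realType} (a b E : R) (P : R -> Prop) :
  (\forall z \near within [set` `]a, b]] (nbhs E), P z) <->
  exists2 d, 0 < d & forall z, a < z <= b -> `|z - E| < d -> P z.
Proof.
split=> [|[d d0 h]].
  rewrite /prop_near1 /within /= => /nbhs_ballP[d d0 h]; exists d => // z zab zE.
  by apply: h; rewrite /= ?in_itv //= -ball_normE /= distrC.
rewrite /prop_near1 /within /=; apply/nbhs_ballP; exists d => // z.
by rewrite -ball_normE /= distrC => zE; rewrite in_itv /= => zab; exact: h.
Qed.

Lemma cvg_itv_oc {R : realType} {V : normedModType R} (a b E : R) (y : R -> V) (l : V) :
  y z @[z --> within [set` `]a, b]] (nbhs E)] --> l <->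
  forall e, 0 < e -> exists2 d, 0 < d &
    forall z, a < z <= b -> `|z - E| < d -> `|y z - l| <= e.
Proof.
split=> [h e e0|h].
  apply/near_itv_oc; move/cvgrPdist_le: h => /(_ _ e0).
  by apply: filterS => z; rewrite distrC.
apply/cvgrPdist_le => e /h /near_itv_oc; apply: filterS => z.
by rewrite distrC.
Qed.

Lemma near_itv_oc_punctured {R : realType} (a b E : R) (P : R -> Prop) :
  (\forall z \near within [set` `]a, b]] E^', P z) <->
  exists2 d, 0 < d & forall z, a < z <= b -> z != E -> `|z - E| < d -> P z.
Proof.
split=> [|[d d0 h]].
  rewrite /prop_near1 /within /= => /nbhs_ballP[d d0 h]; exists d => // z zab zNE zE.
  by apply: h; rewrite /= ?in_itv //= -ball_normE /= distrC.
rewrite /prop_near1 /within /=; apply/nbhs_ballP; exists d => // z.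
by rewrite -ball_normE /= distrC => zE zNE; rewrite in_itv /= => zab; exact: h.
Qed.

Lemma cvg_itv_oc_punctured {R : realType} {V : normedModType R} (a b E : R)
    (y : R -> V) (l : V) :
  y z @[z --> within [set` `]a, b]] E^'] --> l <->
  forall e, 0 < e -> exists2 d, 0 < d &
    forall z, a < z <= b -> z != E -> `|z - E| < d -> `|y z - l| <= e.
Proof.
split=> [h e e0|h].
  apply/near_itv_oc_punctured; move/cvgrPdist_le: h => /(_ _ e0).
  by apply: filterS => z; rewrite distrC.
apply/cvgrPdist_le => e /h /near_itv_oc_punctured; apply: filterS => z.
by rewrite distrC.
Qed.

Lemma is_derive_local {R : realType} (g : R -> R) (x l : R) :
  (forall e, 0 < e -> exists2 d, 0 < d &
    forall z, `|z - x| < d -> `|g z - g x - (z - x) * l| <= e * `|z - x|) ->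
  is_derive x 1 g l.
Proof.
move=> h.
have : (fun t => t^-1 *: (g (t *: 1 + x) - g x)) t @[t --> 0^'] --> l.
  apply/cvgrPdist_le => e /h[d d0 hd].
  apply/nbhs_ballP; exists d => // t; rewrite -ball_normE /= sub0r normrN => td t0.
  have := hd (t + x); rewrite addrK => /(_ td).
  rewrite /GRing.scale /= mulr1 => ht.
  have -> : l - t^-1 * (g (t + x) - g x) = - (t^-1 * (g (t + x) - g x - t * l)).
    by rewrite [in RHS]mulrBr mulKf // opprB.
  by rewrite normrN normrM normfV mulrC ler_pdivrMr // normr_gt0.
by move=> hc; split; [apply/cvg_ex; exists l|exact: cvg_lim].
Qed.

(** Only increments inside [a, b] are controlled, so that the lemma applies
    to functions whose derivative at an end is one-sided. *)
Lemma cst_of_little_increments {R : realType} (g : R -> R) (a b : R) : a <= b ->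
  (forall E e, a <= E <= b -> 0 < e -> exists2 d, 0 < d &
    forall z, a <= z <= b -> `|z - E| < d -> `|g z - g E| <= e * `|z - E|) ->
  g a = g b.
Proof.
rewrite le_eqVlt => /orP[/eqP-> //|ab] h.
have [] := @MVT R g (fun=> 0) a b ab.
- move=> x; rewrite in_itv /= => /andP[ax xb]; apply: is_derive_local => e e0.
  have [d d0 hd] := h x e (introT andP (conj (ltW ax) (ltW xb))) e0.
  exists (Num.min d (Num.min (x - a) (b - x))).
    by rewrite !lt_min d0 !subr_gt0 ax.
  move=> z; rewrite !lt_min => /and3P[zd za zb]; rewrite mulr0 subr0.
  by apply: hd => //; move: za zb; rewrite !ltr_norml => /andP[? ?] /andP[? ?];
    apply/andP; split; lra.
- apply/subspace_continuousP => x; rewrite /= in_itv /= => xab.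
  have [d d0 hd] := h x 1 xab ltr01.
  apply/cvgrPdist_le => e e0; rewrite /prop_near1 /within /=.
  apply/nbhs_ballP; exists (Num.min d e) => [|z]; first by rewrite /= lt_min d0.
  rewrite -ball_normE /= lt_min => /andP[zd ze]; rewrite in_itv /= => zab.
  by rewrite distrC (le_trans (hd _ zab _)) // ?mul1r distrC // ltW.
- by move=> c _; rewrite mul0r => /eqP; rewrite subr_eq0 => /eqP.
Qed.

(** * Level curves as solutions of the initial value problem *)

Section Branches.
Context {R : realType} {N : nat}.
Variables (f : 'rV[R]_N -> 'rV[R]_N) (J : 'rV[R]_N -> 'M[R]_N) (U : set 'rV[R]_N) (v p0 : 'rV[R]_N) (b : R).
Hypothesis openU : open U.
Hypothesis f_strict : forall p, U p -> strict_diff f p (mulmxr (J p)).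
Hypothesis fp0 : f p0 = b *: v.

Definition regular (p : 'rV[R]_N) : Prop := U p /\ J p \in unitmx.

(** Initial value problem y' = v J(y)^-1 in row form, with the derivative
    at E taken relative to ]a, b]. *)
Definition flow (a : R) (y : R -> 'rV[R]_N) : Prop :=
  y b = p0 /\ forall E, a < E <= b ->
    regular (y E) /\
    (z - E)^-1 *: (y z - y E) @[z --> within [set` `]a, b]] E^']
      --> v *m invmx (J (y E)).

(** Integrated form of flow: the derivative of y has disappeared, so that
    branches can be compared and glued by continuity alone. *)
Definition branch (a : R) (y : R -> 'rV[R]_N) : Prop :=
  y b = p0 /\ forall E, a < E <= b ->
    [/\ regular (y E), f (y E) = E *: v &
        y z @[z --> within [set` `]a, b]] (nbhs E)] --> y E].

Lemma cvg_det_jacobian p : U p ->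
  \det (J q) @[q --> p] --> \det (J p).
Proof.
move=> Up; apply: (@cvg_det _ _ (nbhs p)) => i j.
apply: strict_diff_matrix_cvg.
have : nbhs p U by exact: open_nbhs_nbhs.
by apply: (@filterS _ (nbhs p)) => q; exact: f_strict.
Qed.

Lemma near_regular p : regular p -> exists2 d, 0 < d &
  forall q, `|q - p| < d -> regular q.
Proof.
move=> [Up Jp].
have d0 : 0 < `|\det (J p)| by rewrite normr_gt0 -unitfE -unitmxE.
have nU : \forall q \near p, U q by exact: open_nbhs_nbhs.
have nD : \forall q \near p, `|\det (J p) - \det (J q)| < `|\det (J p)|.
  by have /cvgrPdist_lt := cvg_det_jacobian p Up; apply.
have /nbhs_ballP[d dpos h] : \forall q \near p,
    U q /\ `|\det (J p) - \det (J q)| < `|\det (J p)| by exact: filterI.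
exists d => // q qp; have [|Uq hq] := h q; first by rewrite -ball_normE /= distrC.
split=> //; rewrite unitmxE unitfE; apply/eqP => q0; move: hq.
by rewrite q0 subr0 ltxx.
Qed.

(** The increments of f (y E) - E *: v are negligible with respect to those of
    E, since f is strictly differentiable and y' J(y) = v. *)
Lemma flow_branch a y : flow a y -> branch a y.
Proof.
move=> [yb hy]; split; first exact: yb.
move=> E0 aE0b.
have lip E : a < E <= b -> exists2 k, 0 < k & exists2 d, 0 < d &
   forall z, a < z <= b -> `|z - E| < d -> `|y z - y E| <= k * `|z - E|.
  move=> aEb; have [_ /cvg_itv_oc_punctured/(_ _ ltr01)[d d0 hd]] := hy _ aEb.
  set l := v *m _ in hd; exists (1 + `|l|); first by rewrite ltr_pwDl.
  exists d => // z zab zE.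
  have [->|zNE] := eqVneq z E; first by rewrite !subrr !normr0 mulr0.
  have := hd _ zab zNE zE; have zn0 : z - E != 0 by rewrite subr_eq0.
  move=> h; have : `|(z - E)^-1 *: (y z - y E)| <= 1 + `|l|.
    rewrite -(subrK l (_ *: _)) (le_trans (ler_normD _ _)) // lerD2r //.
  by rewrite normrZ normfV mulrC ler_pdivrMr // normr_gt0.
have cont E : a < E <= b -> y z @[z --> within [set` `]a, b]] (nbhs E)] --> y E.
  move=> /lip[k k0 [d d0 h]]; apply/cvg_itv_oc => e e0.
  exists (Num.min d (k^-1 * e)) => [|z zab].
    by rewrite lt_min d0 mulr_gt0 // invr_gt0.
  rewrite lt_min => /andP[zd ze]; rewrite (le_trans (h _ zab zd)) //.
  by rewrite -ler_pdivlMl // ltW.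
split; [by have [] := hy _ aE0b| |exact: cont].
apply/rowP => j; apply/eqP; rewrite -subr_eq0; apply/eqP.
pose g E := f (y E) 0 j - (E *: v) 0 j.
have gb : g b = 0 by rewrite /g yb fp0 subrr.
rewrite -/(g E0) -gb; move: aE0b => /andP[aE0 E0b].
apply: (cst_of_little_increments g) => // E e E0Eb e0.
have aEb : a < E <= b.
  by case/andP: E0Eb => h1 ->; rewrite (lt_le_trans aE0 h1).
have [[Uy Jy] /cvg_itv_oc_punctured hq] := hy _ aEb.
have [k k0 [d d0 hd]] := lip _ aEb.
set L := J (y E) in Jy hq.
pose C := 1 + N%:R * `|L|.
have C0 : 0 < C by rewrite ltr_pwDl // mulr_ge0.
have e1 : 0 < e / (2 * k) by rewrite divr_gt0 // mulr_gt0.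
have e2 : 0 < e / (2 * C) by rewrite divr_gt0 // mulr_gt0.
have [d1 d10 hd1] := (strict_diffP _ _ _).1 (f_strict _ Uy) _ e1.
have [d2 d20 hd2] := hq _ e2.
exists (Num.min (Num.min d d2) (k^-1 * d1)) => [|z E0zb].
  by rewrite !lt_min d0 d20 mulr_gt0 // invr_gt0.
have azb : a < z <= b.
  by case/andP: E0zb => h1 ->; rewrite (lt_le_trans aE0 h1).
rewrite !lt_min => /andP[/andP[zd zd2] zd1].
have [->|zNE] := eqVneq z E; first by rewrite !subrr !normr0 mulr0.
have zn0 : z - E != 0 by rewrite subr_eq0.
have yz : `|y z - y E| <= k * `|z - E| by exact: hd.
have yzd1 : `|y z - y E| < d1 by rewrite (le_lt_trans yz) // -ltr_pdivlMl.
have F1 := hd1 _ (y E) yzd1 (_ : `|y E - y E| < d1).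
rewrite subrr normr0 in F1; have {}F1 := F1 d10; rewrite -/L in F1.
have F2 := hd2 _ azb zNE zd2.
have -> : g z - g E = (f (y z) - f (y E) - (z - E) *: v) 0 j.
  rewrite /g !mxE; ring.
rewrite (le_trans (mx_coord_le _ _ _ _ 0 j)) //.
have -> : f (y z) - f (y E) - (z - E) *: v =
  (f (y z) - f (y E) - (y z - y E) *m L)
  + (z - E) *: (((z - E)^-1 *: (y z - y E) - v *m invmx L) *m L).
  set u := y z - y E.
  rewrite (mulmxBl (_ *: u)) mulmxKV // scalerBr -scalemxAl scalerA mulfV // scale1r.
  by rewrite addrA subrK.
rewrite (le_trans (ler_normD _ _)) // [e]splitr mulrDl lerD //.
  rewrite (le_trans F1) // (le_trans (y := e / (2 * k) * (k * `|z - E|))) //.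
    by rewrite ler_pM2l.
  by rewrite invfM !mulrA mulfVK // gt_eqF.
rewrite normrZ mulrC ler_wpM2r //.
rewrite (le_trans (norm_mulmx_le _ _ _ _ _ _)) //.
rewrite (le_trans (y := C * (e / (2 * C)))) //.
  by rewrite ler_pM // ?mulr_ge0 // /C lerDr.
have Cn0 : C != 0 by rewrite gt_eqF.
by rewrite le_eqVlt; apply/orP; left; apply/eqP; field.
Qed.

(** Local inversion makes y Lipschitz near E; the estimate of f (y z) - f (y E)
    by the differential, multiplied by J(y)^-1, then gives the quotient. *)
Lemma branch_flow a y : branch a y -> flow a y.
Proof.
move=> [yb hy]; split=> // E aEb.
have [[Uy Jy] fy /cvg_itv_oc cy] := hy _ aEb; split=> //.
have fs := f_strict _ Uy.
have [K [d0 [K0 d00 inj _]]] := local_inverse _ _ _ fs Jy.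
set L := J (y E) in Jy fs *.
pose C := 1 + N%:R * `|invmx L|.
have C0 : 0 < C by rewrite ltr_pwDl // mulr_ge0.
have V0 : 0 < 1 + `|v| by rewrite ltr_pwDl.
apply/cvg_itv_oc_punctured => e e0.
have e'0 : 0 < e / (C * K * (1 + `|v|)) by rewrite divr_gt0 // !mulr_gt0.
have [d1 d10 hd1] := (strict_diffP _ _ _).1 fs _ e'0.
have m0 : 0 < Num.min d0 d1 / 2 by rewrite divr_gt0 // lt_min d00.
have [d d_gt0 hd] := cy _ m0.
exists d => // z azb zNE zE.
have zn0 : z - E != 0 by rewrite subr_eq0.
have [_ fz _] := hy _ azb.
have yzlt : `|y z - y E| < Num.min d0 d1.
  apply: (le_lt_trans (hd _ azb zE)); rewrite ltr_pdivrMr // mulr_natr mulr2n.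
  by rewrite ltrDl lt_min d00.
move: yzlt; rewrite lt_min => /andP[yd0 yd1].
have yEd0 : `|y E - y E| < d0 by rewrite subrr normr0.
have yEd1 : `|y E - y E| < d1 by rewrite subrr normr0.
have fE : f (y z) - f (y E) = (z - E) *: v by rewrite fz fy scalerBl.
have b1 := inj _ _ yd0 yEd0; have b2 := hd1 _ _ yd1 yEd1.
rewrite fE normrZ in b1; rewrite fE /= in b2.
move: (y z - y E) b1 b2 => u b1 b2.
have -> : (z - E)^-1 *: u - v *m invmx L =
    - ((z - E)^-1 *: (((z - E) *: v - u *m L) *m invmx L)).
  rewrite (mulmxBl ((z - E) *: v)) mulmxK // scalerBr -scalemxAl scalerA mulVf //.
  by rewrite scale1r opprB.
rewrite normrN normrZ normfV mulrC ler_pdivrMr ?normr_gt0 //.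
rewrite (le_trans (norm_mulmx_le _ _ _ _ _ _)) //.
rewrite (le_trans (y := C * (e / (C * K * (1 + `|v|)) * (K * (`|z - E| * (1 + `|v|)))))) //.
  rewrite ler_pM ?mulr_ge0 //; first by rewrite /C lerDr.
  apply: (le_trans b2); rewrite ler_pM2l // (le_trans b1) // ler_pM2l //.
  by rewrite ler_wpM2l // lerDr.
have Cn0 : C != 0 by rewrite gt_eqF.
have Kn0 : K != 0 by rewrite gt_eqF.
have Vn0 : 1 + `|v| != 0 by rewrite gt_eqF.
rewrite le_eqVlt; apply/orP; left; apply/eqP; field.
by rewrite ?Cn0 ?Kn0 ?Vn0.
Qed.

Lemma branch_restrict a a' y : a <= a' -> branch a y -> branch a' y.
Proof.
move=> aa' [yb hy]; split=> // E /andP[aE Eb].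
have [ry fy /cvg_itv_oc cy] := hy E (introT andP (conj (le_lt_trans aa' aE) Eb)).
split=> //; apply/cvg_itv_oc => e /cy[d d0 hd]; exists d => // z /andP[az zb].
by apply: hd; rewrite zb (le_lt_trans aa').
Qed.

(** Agreement of two branches propagates to the left by local injectivity of
    f, and disagreement propagates to the right by continuity. *)
Lemma branch_unique a y z : branch a y -> branch a z ->
  forall E, a < E <= b -> y E = z E.
Proof.
move=> [yb hy] [zb hz] E1 aE1b; apply/eqP/negPn/negP => neq1.
pose B := [set E | E1 <= E <= b /\ y E != z E].
have E1b : E1 <= b by case/andP: aE1b.
have aE1 : a < E1 by case/andP: aE1b.
have BE1 : B E1 by rewrite /B /= lexx E1b.
have supB : has_sup B.
  by split; [exists E1|exists b => E [/andP[]]].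
pose s := sup B.
have E1s : E1 <= s by apply: (ub_le_sup _ BE1); case: supB.
have sb : s <= b by apply: ge_sup; [exists E1|move=> E [/andP[]]].
have asb : a < s <= b by rewrite sb (lt_le_trans aE1).
have [[Us Js] fs /cvg_itv_oc cy] := hy _ asb.
have [_ _ /cvg_itv_oc cz] := hz _ asb.
have [ys|ys] := eqVneq (y s) (z s).
  have [K [d0 [K0 d00 inj _]]] := local_inverse _ _ _ (f_strict _ Us) Js.
  have h0 : 0 < d0 / 2 by rewrite divr_gt0.
  have h0' : d0 / 2 < d0 by rewrite ltr_pdivrMr // mulr_natr mulr2n ltrDl.
  have [d1 d10 h1] := cy _ h0; have [d2 d20 h2] := cz _ h0.
  have m0 : 0 < Num.min d1 d2 by rewrite lt_min d10.
  have [t [Bt1 Bt2] st] := sup_adherent m0 supB; rewrite -/s in st.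
  have ts : t <= s by apply: (ub_le_sup _ (conj Bt1 Bt2 : B t)); case: supB.
  have atb : a < t <= b by case/andP: Bt1 => h ->; rewrite (lt_le_trans aE1).
  have : `|t - s| < Num.min d1 d2 by rewrite distrC ger0_norm ?subr_ge0 // ltrBlDr addrC -ltrBlDr.
  rewrite lt_min => /andP[td1 td2].
  have i1 := le_lt_trans (h1 _ atb td1) h0'.
  have i2 := le_lt_trans (h2 _ atb td2) h0'; rewrite -ys in i2.
  have := inj _ _ i1 i2.
  have [_ -> _] := hy _ atb; have [_ -> _] := hz _ atb.
  rewrite subrr normr0 mulr0 normr_le0 subr_eq0 => yzt.
  by move: Bt2; rewrite yzt.
have sltb : s < b.
  by rewrite lt_neqAle sb andbT; apply: contraNneq ys => ->; rewrite yb zb.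
have n0 : 0 < `|y s - z s| / 3 by rewrite divr_gt0 // normr_gt0 subr_eq0.
have [d1 d10 h1] := cy _ n0; have [d2 d20 h2] := cz _ n0.
pose t := s + Num.min (Num.min d1 d2) (b - s) / 2.
have m0 : 0 < Num.min (Num.min d1 d2) (b - s) by rewrite !lt_min d10 d20 subr_gt0.
have st : s < t by rewrite ltrDl divr_gt0.
have : t - s < Num.min (Num.min d1 d2) (b - s).
  by rewrite /t addrC addKr ltr_pdivrMr // mulr_natr mulr2n ltrDl.
rewrite !lt_min ltrD2r => /andP[/andP[td1 td2] tb].
have atb : a < t <= b by rewrite (ltW tb) andbT (lt_trans _ st) //; case/andP: asb.
have nts : `|t - s| = t - s by rewrite ger0_norm // subr_ge0 ltW.
have Bt : B t.
  split; first by rewrite (ltW tb) andbT (le_trans E1s) // ltW.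
  apply/eqP => yzt; have i1 := h1 _ atb; have i2 := h2 _ atb.
  rewrite nts in i1 i2; move: (i1 td1) (i2 td2); rewrite yzt => j1 j2.
  have : `|y s - z s| <= `|y s - z s| / 3 + `|y s - z s| / 3.
    rewrite {1}(_ : y s - z s = (z t - z s) - (z t - y s)).
      by rewrite (le_trans (ler_normB _ _)) // lerD.
    by rewrite opprB [RHS]addrC addrA subrK.
  by move: n0; lra.
have : t <= s by apply: (ub_le_sup _ Bt); case: supB.
by rewrite leNgt st.
Qed.

(** Local uniqueness, the last part, is what lets a branch known only by its
    values be recognized as the local one. *)
Lemma local_branch p c : regular p -> f p = c *: v ->
  exists d e eta, [/\ 0 < d, 0 < e,
    forall E, `|E - c| < e ->
      [/\ regular (eta E), f (eta E) = E *: v & eta z @[z --> E] --> eta E] &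
    forall E q, `|E - c| < e -> `|q - p| < d -> f q = E *: v -> q = eta E].
Proof.
move=> rp fp; have [Up Jp] := rp.
have [K [d0 [K0 d00 inj surj]]] := local_inverse _ _ _ (f_strict _ Up) Jp.
have [d1 d10 regd] := near_regular p rp.
pose d := Num.min d0 d1.
have d_gt0 : 0 < d by rewrite lt_min d00.
have [e' e'0 he'] := surj _ d_gt0.
have V0 : 0 < 1 + `|v| by rewrite ltr_pwDl.
pose e := e' / (1 + `|v|).
have e0 : 0 < e by rewrite divr_gt0.
have ex E : exists q, `|E - c| < e -> `|q - p| < d /\ f q = E *: v.
  have [Ee|] := boolP (`|E - c| < e); last by exists 0.
  have [|q qp fq] := he' (E *: v); last by exists q.
  rewrite fp -scalerBl normrZ (le_lt_trans (y := `|E - c| * (1 + `|v|))) //.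
    by rewrite ler_wpM2l // lerDr.
  by rewrite -ltr_pdivlMr.
pose eta E := sval (cid (ex E)).
have etaP E : `|E - c| < e -> `|eta E - p| < d /\ f (eta E) = E *: v.
  by rewrite /eta; case: cid.
exists d, e, eta; split => // [E Ee|E q Ee qp fq]; last first.
  have [ep fe] := etaP _ Ee.
  move: qp ep; rewrite !lt_min => /andP[q0 _] /andP[ep0 _].
  have := inj _ _ q0 ep0; rewrite fq fe subrr normr0 mulr0 normr_le0 subr_eq0.
  by move/eqP.
have [ep fe] := etaP _ Ee; have := ep; rewrite lt_min => /andP[ep0 ep1].
split=> //; first exact: regd.
apply/cvgrPdist_le => r r0.
have m0 : 0 < Num.min (e - `|E - c|) (r / (K * (1 + `|v|))).
  by rewrite lt_min subr_gt0 Ee divr_gt0 // mulr_gt0.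
apply: filterS (near_dist_lt _ _ E _ m0) => z; rewrite lt_min => /andP[z1 z2].
have ze : `|z - c| < e.
  by rewrite -(subrK E z) -addrA (le_lt_trans (ler_normD _ _)) // -ltrBrDr.
have [zp fz] := etaP _ ze; move: zp; rewrite lt_min => /andP[zp0 _].
rewrite (le_trans (inj _ _ ep0 zp0)) // fe fz -scalerBl normrZ distrC.
rewrite (le_trans (y := K * (`|z - E| * (1 + `|v|)))) //.
  by rewrite ler_pM2l // ler_wpM2l // lerDr.
by move: z2; rewrite ltr_pdivlMr ?mulr_gt0 // mulrCA => /ltW.
Qed.

Lemma branch_exists : regular p0 -> 0 < b ->
  exists a y, [/\ 0 <= a, a < b & branch a y].
Proof.
move=> rp b0; have [d [e [eta [d0 e0 h1 h2]]]] := local_branch p0 b rp fp0.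
pose a := Num.max 0 (b - e).
exists a, eta; split; [by rewrite le_max lexx|by rewrite gt_max b0 ltrBlDr ltrDl|].
split; first by apply/esym/h2; rewrite ?subrr ?normr0.
move=> E /andP[aE Eb].
have Ee : `|E - b| < e.
  rewrite distrC ger0_norm ?subr_ge0 // ltrBlDr addrC -ltrBlDr.
  by apply: le_lt_trans aE; rewrite le_max lexx orbT.
have [r1 r2 r3] := h1 _ Ee; split=> //.
exact: cvg_within_filter r3.
Qed.

(** Near p the local branch through p contains all solutions of f q = E *: v, so
    y meets it at some E1 close to a; the two branches are glued at E1. *)
Lemma branch_extend a y p : 0 < a -> a < b -> branch a y -> regular p ->
  f p = a *: v ->
  (forall d, 0 < d -> exists E, [/\ a < E <= b, E < a + d & `|y E - p| < d]) ->
  exists a' z, [/\ 0 <= a', a' < a & branch a' z].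
Proof.
move=> a0 ab [yb hy] rp fp clus.
have [d [e [eta [d0 e0 h1 h2]]]] := local_branch p a rp fp.
have m0 : 0 < Num.min d e by rewrite lt_min d0.
have [E1 [aE1b E1m yE1]] := clus _ m0.
have E1e : `|E1 - a| < e.
  case/andP: aE1b => h _; rewrite ger0_norm ?subr_ge0 1?ltW // ltrBlDl.
  by apply: (lt_le_trans E1m); rewrite lerD2l ge_min lexx orbT.
have yeta : y E1 = eta E1.
  apply: h2 => //; first by apply: (lt_le_trans yE1); rewrite ge_min lexx.
  by have [] := hy _ aE1b.
pose a' := Num.max 0 (a - e).
have a'a : a' < a by rewrite gt_max a0 ltrBlDr ltrDl.
exists a', (fun E => if E < E1 then eta E else y E).
split=> //; first by rewrite le_max lexx.
case/andP: aE1b => aE1 E1b.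
split; first by rewrite ltNge E1b.
have eta_e E : a' < E -> E <= E1 -> `|E - a| < e.
  rewrite gt_max => /andP[_ aeE] EE1; move: E1e.
  rewrite ger0_norm ?subr_ge0 1?ltW // => E1e; rewrite ltr_norml.
  by apply/andP; split; lra.
move=> E /andP[a'E Eb].
have contE (E' : R) : a' < E' -> E' <= E1 -> forall r, 0 < r -> exists2 t, 0 < t &
    forall z, `|z - E'| < t -> `|eta z - eta E'| <= r.
  move=> l1 l2 r r0; have [_ _ /cvgrPdist_le/(_ _ r0)/nbhs_ballP[t t0 ht]] := h1 _ (eta_e _ l1 l2).
  by exists t => // z zE; rewrite distrC; apply: ht; rewrite -ball_normE /= distrC.
have conty (E' : R) : E1 <= E' -> E' <= b -> forall r, 0 < r -> exists2 t, 0 < t &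
    forall z, E1 <= z <= b -> `|z - E'| < t -> `|y z - y E'| <= r.
  move=> l1 l2 r r0.
  have [|_ _ /cvg_itv_oc/(_ _ r0)[t t0 ht]] := hy E'; first by rewrite l2 andbT (lt_le_trans aE1).
  by exists t => // z /andP[z1 z2] zE; apply: ht => //; rewrite z2 andbT (lt_le_trans aE1).
have [EE1|E1E|EE1] := ltgtP E E1.
- have [r1 r2 _] := h1 _ (eta_e _ a'E (ltW EE1)); split=> //.
  apply/cvg_itv_oc => r r0; have [t t0 ht] := contE _ a'E (ltW EE1) _ r0.
  exists (Num.min t (E1 - E)) => [|z zab]; first by rewrite lt_min t0 subr_gt0.
  rewrite lt_min => /andP[z1 z2].
  have -> : z < E1 by move: z2; rewrite ltr_norml => /andP[_]; lra.
  exact: ht.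
- have [|r1 r2 _] := hy E; first by rewrite Eb (lt_trans aE1).
  split=> //; apply/cvg_itv_oc => r r0; have [t t0 ht] := conty _ (ltW E1E) Eb _ r0.
  exists (Num.min t (E - E1)) => [|z /andP[za zb]]; first by rewrite lt_min t0 subr_gt0.
  rewrite lt_min => /andP[z1 z2].
  have E1z : E1 < z by move: z2; rewrite ltr_norml => /andP[+ _]; lra.
  by rewrite ltNge (ltW E1z) /=; apply: ht => //; rewrite (ltW E1z).
- have [|r1 r2 _] := hy E; first by rewrite Eb EE1 aE1.
  split=> //; apply/cvg_itv_oc => r r0.
  have lE : E <= E1 by rewrite EE1.
  have gE : E1 <= E by rewrite EE1.
  have [t t0 ht] := contE _ a'E lE _ r0.
  have [t' t'0 ht'] := conty _ gE Eb _ r0.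
  exists (Num.min t t') => [|z /andP[za zb]]; first by rewrite lt_min t0.
  rewrite lt_min => /andP[z1 z2].
  case: ltP => [zE1|E1z].
    by move: (ht _ z1); rewrite EE1 yeta.
  by apply: ht' => //; rewrite E1z.
Qed.

(** The union of all branches, which agree wherever two of them are defined. *)
Lemma maximal_branch_exists : regular p0 -> 0 < b ->
  exists a y, [/\ 0 <= a, a < b, branch a y &
    forall a' z, 0 <= a' -> a' < b -> branch a' z -> a <= a'].
Proof.
move=> rp b0; have [a0 [y0 [a00 a0b by0]]] := branch_exists rp b0.
pose S := [set a | [/\ 0 <= a, a < b & exists y, branch a y]].
have Sa0 : S a0 by split => //; exists y0.
have infS : has_inf S by split; [exists a0|exists 0 => a []].
pose m := inf S.
have mlb a : S a -> m <= a by move=> Sa; apply: ge_inf Sa; case: infS.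
have ex E : exists q, m < E <= b -> exists a z, [/\ S a, a < E, branch a z & q = z E].
  have [/andP[mE Eb]|] := boolP (m < E <= b); last by exists 0.
  have e0 : 0 < E - m by rewrite subr_gt0.
  have [a Sa] := inf_adherent e0 infS; rewrite -/m addrC subrK => aE.
  by have [_ _ [z bz]] := Sa; exists (z E) => _; exists a, z.
pose y E := sval (cid (ex E)).
have yP E : m < E <= b -> exists a z, [/\ S a, a < E, branch a z & y E = z E].
  by rewrite /y; case: cid.
have yE a z : branch a z -> forall E, a < E <= b -> m < E -> y E = z E.
  move=> bz E /andP[aE Eb] mE; have [|a' [z' [Sa' a'E bz' ->]]] := yP E; first by rewrite mE.
  have [aa'|a'a] := leP a a'.
    by apply: (branch_unique a' z' z) => //; [exact: branch_restrict bz|rewrite a'E].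
  by apply: (branch_unique a z' z) => //; [exact: branch_restrict (ltW a'a) bz'|rewrite aE].
have mb : m < b by apply: le_lt_trans a0b; exact: mlb.
exists m, y; split=> //.
- by apply: lb_le_inf => [|a []]; [exists a0|].
- split; first by have [|a [z [_ _ [zb _] ->]]] := yP b; rewrite ?mb ?lexx.
  move=> E /andP[mE Eb]; have [|a [z [Sa aE bz yEz]]] := yP E; first by rewrite mE.
  have [_ hz] := bz; have [|r1 r2 /cvg_itv_oc r3] := hz E; first by rewrite aE.
  rewrite yEz; split=> //; apply/cvg_itv_oc => e /r3[t t0 ht].
  exists (Num.min t (E - a)) => [|x /andP[mx xb]]; first by rewrite lt_min t0 subr_gt0.
  rewrite lt_min => /andP[x1 x2].
  have ax : a < x by move: x2; rewrite ltr_norml => /andP[+ _]; lra.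
  by rewrite (yE _ _ bz) ?ax //; apply: ht; rewrite ?ax.
- by move=> a' z a'0 a'b bz; apply: mlb; split=> //; exists z.
Qed.

End Branches.

(** * The differential of the system *)

Section StateCoordinates.
Context {R : realType} {m n : nat}.
Implicit Types y z : state R m n.

Definition i_lambda : 'I_(1 + 1 + m + n) := lshift n (lshift m (lshift 1 ord0)).
Definition i_mu : 'I_(1 + 1 + m + n) := lshift n (lshift m (rshift 1 ord0)).
Definition i_w (i : 'I_m) : 'I_(1 + 1 + m + n) := lshift n (rshift (1 + 1) i).
Definition i_x (j : 'I_n) : 'I_(1 + 1 + m + n) := rshift (1 + 1 + m) j.

Lemma lambda_ofE y : lambda_of y = y 0 i_lambda.
Proof. by rewrite /lambda_of !mxE. Qed.

Lemma mu_ofE y : mu_of y = y 0 i_mu.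
Proof. by rewrite /mu_of !mxE. Qed.

Lemma w_ofE y i : w_of y i 0 = y 0 (i_w i).
Proof. by rewrite /w_of !mxE. Qed.

Lemma x_ofE y j : x_of y j 0 = y 0 (i_x j).
Proof. by rewrite /x_of !mxE. Qed.

Lemma state_index (P : 'I_(1 + 1 + m + n) -> Prop) :
  P i_lambda -> P i_mu -> (forall i, P (i_w i)) -> (forall j, P (i_x j)) ->
  forall k, P k.
Proof.
move=> Pl Pm Pw Px k; case: (split_ordP k) => [k1|j] ->; last exact: Px.
case: (split_ordP k1) => [k2|i] ->; last exact: Pw.
by case: (split_ordP k2) => i ->; rewrite (ord1 i).
Qed.

Lemma state_ext y z : lambda_of y = lambda_of z -> mu_of y = mu_of z ->
  (forall i, w_of y i 0 = w_of z i 0) -> (forall j, x_of y j 0 = x_of z j 0) -> y = z.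
Proof.
rewrite !lambda_ofE !mu_ofE => hl hm hw hx; apply/rowP.
apply: state_index => // [i|j]; first by have := hw i; rewrite !w_ofE.
by have := hx j; rewrite !x_ofE.
Qed.

Lemma lambda_mk l u w x : lambda_of (mk_state l u w x : state R m n) = l.
Proof. by rewrite /lambda_of /mk_state !row_mxKl mxE eqxx. Qed.

Lemma mu_mk l u w x : mu_of (mk_state l u w x : state R m n) = u.
Proof. by rewrite /mu_of /mk_state !(row_mxKl, row_mxKr) mxE eqxx. Qed.

Lemma w_mk l u w x : w_of (mk_state l u w x : state R m n) = w.
Proof. by rewrite /w_of /mk_state !(row_mxKl, row_mxKr) trmxK. Qed.

Lemma x_mk l u w x : x_of (mk_state l u w x : state R m n) = x.
Proof. by rewrite /x_of /mk_state !(row_mxKl, row_mxKr) trmxK. Qed.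

Lemma lambdaD y z : lambda_of (y + z) = lambda_of y + lambda_of z.
Proof. by rewrite !lambda_ofE mxE. Qed.
Lemma muD y z : mu_of (y + z) = mu_of y + mu_of z.
Proof. by rewrite !mu_ofE mxE. Qed.
Lemma wD y z : w_of (y + z) = w_of y + w_of z.
Proof. by rewrite /w_of -!linearD. Qed.
Lemma xD y z : x_of (y + z) = x_of y + x_of z.
Proof. by rewrite /x_of -!linearD. Qed.
Lemma lambdaZ a y : lambda_of (a *: y) = a * lambda_of y.
Proof. by rewrite !lambda_ofE mxE. Qed.
Lemma muZ a y : mu_of (a *: y) = a * mu_of y.
Proof. by rewrite !mu_ofE mxE. Qed.
Lemma wZ a y : w_of (a *: y) = a *: w_of y.
Proof. by rewrite /w_of !linearZ. Qed.
Lemma xZ a y : x_of (a *: y) = a *: x_of y.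
Proof. by rewrite /x_of !linearZ. Qed.

Lemma wDi y z i : w_of (y + z) i 0 = w_of y i 0 + w_of z i 0.
Proof. by rewrite wD mxE. Qed.
Lemma wZi a y i : w_of (a *: y) i 0 = a * w_of y i 0.
Proof. by rewrite wZ mxE. Qed.
Lemma xDi y z j : x_of (y + z) j 0 = x_of y j 0 + x_of z j 0.
Proof. by rewrite xD mxE. Qed.
Lemma xZi a y j : x_of (a *: y) j 0 = a * x_of y j 0.
Proof. by rewrite xZ mxE. Qed.

Definition state_mkE := (lambda_mk, mu_mk, w_mk, x_mk).

End StateCoordinates.

Section Differential.
Context {R : realType} {m n : nat}.
Variables (A : 'M[R]_(m, n)) (b : 'cV[R]_m).
Implicit Types y v : state R m n.

Definition resid (x : 'cV[R]_n) (i : 'I_m) : R := (A *m x - b) i 0.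
(** Variation of the i-th residual in the direction x. *)
Definition slope (x : 'cV[R]_n) (i : 'I_m) : R := (A *m x) i 0.

Lemma lambda_Fsys E y : lambda_of (Fsys A b E y) = \sum_i w_of y i 0 - 1.
Proof. by rewrite state_mkE. Qed.

Lemma mu_Fsys E y :
  mu_of (Fsys A b E y) = \sum_i w_of y i 0 * resid (x_of y) i ^+ 2 - E.
Proof.
rewrite state_mkE; congr (_ - _); rewrite mxE; apply: eq_bigr => i _.
by rewrite [w_of y]lock !mxE -lock /resid !mxE.
Qed.

Lemma w_Fsys E y i : w_of (Fsys A b E y) i 0 =
  ln (w_of y i 0) + (1 + lambda_of y) + mu_of y * resid (x_of y) i ^+ 2.
Proof. by rewrite state_mkE [w_of y]lock ![in LHS]mxE -lock /resid !mxE. Qed.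

Lemma x_Fsys E y j : x_of (Fsys A b E y) j 0 =
  \sum_i A i j * (w_of y i 0 * resid (x_of y) i).
Proof.
rewrite state_mkE -!mulmxA -mulmxBr -mulmxBr mxE; apply: eq_bigr => i _.
by rewrite mxE mul_diag_mx mxE mxE.
Qed.

(** Value at v of the differential of Fsys A b E at y. *)
Definition dF (y v : state R m n) : state R m n :=
  let r := resid (x_of y) in
  mk_state
    (\sum_i w_of v i 0)
    (\sum_i (w_of v i 0 * r i ^+ 2 + w_of y i 0 * (2 * r i * slope (x_of v) i)))
    (\col_i (w_of v i 0 / w_of y i 0 + lambda_of v
       + (mu_of v * r i ^+ 2 + mu_of y * (2 * r i * slope (x_of v) i))))
    (\col_j \sum_i A i j * (w_of v i 0 * r i + w_of y i 0 * slope (x_of v) i)).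

Lemma slopeD x x' i : slope (x + x') i = slope x i + slope x' i.
Proof. by rewrite /slope mulmxDr mxE. Qed.

Lemma slopeZ a x i : slope (a *: x) i = a * slope x i.
Proof. by rewrite /slope -scalemxAr mxE. Qed.

Lemma lambda_dF y v : lambda_of (dF y v) = \sum_i w_of v i 0.
Proof. by rewrite state_mkE. Qed.

Lemma mu_dF y v : mu_of (dF y v) = \sum_i (w_of v i 0 * resid (x_of y) i ^+ 2
  + w_of y i 0 * (2 * resid (x_of y) i * slope (x_of v) i)).
Proof. by rewrite state_mkE. Qed.

Lemma w_dF y v i : w_of (dF y v) i 0 = w_of v i 0 / w_of y i 0 + lambda_of v
  + (mu_of v * resid (x_of y) i ^+ 2
     + mu_of y * (2 * resid (x_of y) i * slope (x_of v) i)).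
Proof. by rewrite state_mkE mxE. Qed.

Lemma x_dF y v j : x_of (dF y v) j 0 =
  \sum_i A i j * (w_of v i 0 * resid (x_of y) i + w_of y i 0 * slope (x_of v) i).
Proof. by rewrite state_mkE mxE. Qed.

Lemma dF_linear y : linear (dF y).
Proof.
move=> a u v; apply: state_ext => [| |i|j].
- rewrite lambdaD lambdaZ !lambda_dF mulr_sumr -big_split /=.
  by apply: eq_bigr => i _; rewrite wDi wZi.
- rewrite muD muZ !mu_dF mulr_sumr -big_split /=.
  by apply: eq_bigr => i _; rewrite wDi wZi xD xZ slopeD slopeZ; ring.
- rewrite wDi wZi !w_dF wDi wZi xD xZ slopeD slopeZ lambdaD lambdaZ muD muZ; ring.
- rewrite xDi xZi !x_dF mulr_sumr -big_split /=.
  by apply: eq_bigr => i _; rewrite wDi wZi xD xZ slopeD slopeZ; ring.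
Qed.

HB.instance Definition _ y := GRing.isLinear.Build R _ _ *:%R (dF y) (dF_linear y).

Lemma sdiff_eq (V : normedModType R) (f g df dg : V -> R) p :
  sdiff f p df -> f =1 g -> df =1 dg -> sdiff g p dg.
Proof. by move=> + /funext <- /funext <-. Qed.

Lemma sdiff_lambda y : sdiff (fun y : state R m n => lambda_of y) y (fun v => lambda_of v).
Proof. by apply: sdiff_eq (sdiff_coord y i_lambda) _ _ => v; rewrite lambda_ofE. Qed.

Lemma sdiff_mu y : sdiff (fun y : state R m n => mu_of y) y (fun v => mu_of v).
Proof. by apply: sdiff_eq (sdiff_coord y i_mu) _ _ => v; rewrite mu_ofE. Qed.

Lemma sdiff_w y i :
  sdiff (fun y : state R m n => w_of y i 0) y (fun v => w_of v i 0).
Proof. by apply: sdiff_eq (sdiff_coord y (i_w i)) _ _ => v; rewrite w_ofE. Qed.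

Lemma sdiff_x y j :
  sdiff (fun y : state R m n => x_of y j 0) y (fun v => x_of v j 0).
Proof. by apply: sdiff_eq (sdiff_coord y (i_x j)) _ _ => v; rewrite x_ofE. Qed.

Lemma sdiff_resid y i : sdiff (fun y : state R m n => resid (x_of y) i) y
  (fun v : state R m n => slope (x_of v) i).
Proof.
have h := sdiffD _ _ _ _ _ (sdiff_sum _ _ _ _
  (fun j => sdiffM _ _ _ _ _ (sdiff_cst (A i j) y) (sdiff_x y j)))
  (sdiff_cst (- b i 0) y).
apply: sdiff_eq h _ _ => v; first by rewrite /resid !mxE.
by rewrite /slope mxE addr0; apply: eq_bigr => j _; rewrite mulr0 addr0.
Qed.

Lemma Fsys_strict_diff E y : (forall i, 0 < w_of y i 0) ->
  strict_diff (Fsys A b E) y (mulmxr (lin1_mx (dF y))).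
Proof.
move=> wpos; apply: strict_diff_coord => k.
suff [h _] : sdiff (fun y => Fsys A b E y 0 k) y (fun v => dF y v 0 k).
  have -> : (fun v => (v *m lin1_mx (dF y)) 0 k) = (fun v => dF y v 0 k).
    by apply/funext => v; rewrite mul_rV_lin1.
  exact: h.
move: k; apply: state_index => [| |i|j].
- have h := sdiffD _ _ _ _ _ (sdiff_sum _ _ _ _ (sdiff_w y)) (sdiff_cst (-1) y).
  apply: sdiff_eq h _ _ => v; rewrite -lambda_ofE; first by rewrite lambda_Fsys.
  by rewrite lambda_dF addr0.
- have h := sdiffD _ _ _ _ _ (sdiff_sum _ _ _ _ (fun i =>
    sdiffM _ _ _ _ _ (sdiff_w y i)
      (sdiffM _ _ _ _ _ (sdiff_resid y i) (sdiff_resid y i))))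
    (sdiff_cst (- E) y).
  apply: sdiff_eq h _ _ => v; rewrite -mu_ofE.
    by rewrite mu_Fsys; congr (_ - _); apply: eq_bigr => i _; rewrite expr2.
  by rewrite mu_dF addr0; apply: eq_bigr => i _; ring.
- have h := sdiffD _ _ _ _ _ (sdiffD _ _ _ _ _
    (sdiff_ln _ _ _ (wpos i) (sdiff_w y i))
    (sdiffD _ _ _ _ _ (sdiff_cst 1 y) (sdiff_lambda y)))
    (sdiffM _ _ _ _ _ (sdiff_mu y)
      (sdiffM _ _ _ _ _ (sdiff_resid y i) (sdiff_resid y i))).
  apply: sdiff_eq h _ _ => v; rewrite -w_ofE; first by rewrite w_Fsys expr2.
  rewrite w_dF; ring.
- have h := sdiff_sum _ _ _ _ (fun i => sdiffM _ _ _ _ _ (sdiff_cst (A i j) y)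
    (sdiffM _ _ _ _ _ (sdiff_w y i) (sdiff_resid y i))).
  apply: sdiff_eq h _ _ => v; rewrite -x_ofE; first by rewrite x_Fsys.
  by rewrite x_dF; apply: eq_bigr => i _; ring.
Qed.

Lemma jacobian_Fsys E y : (forall i, 0 < w_of y i 0) ->
  'J (Fsys A b E) y = lin1_mx (dF y).
Proof. by move=> /(Fsys_strict_diff E); exact: strict_diff_jacobian. Qed.

Lemma mulmx_jacobian_Fsys E y v : (forall i, 0 < w_of y i 0) ->
  v *m 'J (Fsys A b E) y = dF y v.
Proof. by move=> /(jacobian_Fsys E) ->; rewrite mul_rV_lin1. Qed.

End Differential.

(** * The least squares state *)

Section LeastSquares.
Context {R : realType} {m n : nat}.
Variables (A : 'M[R]_(m, n)) (b : 'cV[R]_m).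
Hypothesis hA : \rank A = n.
Hypothesis hr : ~ exists c : R, forall i, `|rstar A b i 0| = c.
Local Notation r := (resid A b).
Local Notation xs := (xstar A b).

Lemma col_inj (x : 'cV[R]_n) : (forall i, slope A x i = 0) -> x = 0.
Proof.
move=> h; apply: trmx_inj; rewrite trmx0.
have fA : row_free A^T by rewrite /row_free mxrank_tr hA.
apply: (row_free_inj fA); rewrite mul0mx -trmx_mul.
by apply/rowP => i; rewrite !mxE; have := h i; rewrite /slope mxE.
Qed.

(** v A^T A = 0 makes the squared norm of A v^T vanish. *)
Lemma gram_unit : A^T *m A \in unitmx.
Proof.
rewrite -row_free_unit; apply/inj_row_free => v h.
apply: trmx_inj; rewrite trmx0; apply: col_inj => i.
have : v *m (A^T *m A) *m v^T = 0 by rewrite h mul0mx.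
rewrite !mulmxA -mulmxA => /matrixP/(_ 0 0); rewrite [RHS]mxE mxE.
rewrite (eq_bigr (fun i => slope A v^T i ^+ 2)) => [/eqP|k _].
  rewrite psumr_eq0 => [/allP/(_ i (mem_index_enum i))|k _]; last exact: sqr_ge0.
  by rewrite sqrf_eq0 => /eqP.
have -> : (v *m A^T) 0 k = slope A v^T k.
  by rewrite /slope -[v in LHS]trmxK -trmx_mul mxE.
by rewrite expr2.
Qed.

Lemma normal_eqE x j :
  \sum_i A i j * r x i = (A^T *m (A *m x - b)) j 0.
Proof. by rewrite mxE; apply: eq_bigr => i _; rewrite mxE. Qed.

Lemma normal_eq j : \sum_i A i j * r xs i = 0.
Proof.
rewrite normal_eqE /xstar mulmxBr (mulmxA A^T A) -(mulmxA (invmx _)) mulKVmx ?gram_unit //.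
by rewrite subrr mxE.
Qed.

Lemma normal_eq_unique x : (forall j, \sum_i A i j * r x i = 0) -> x = xs.
Proof.
move=> h; have : A^T *m (A *m x - b) = 0.
  by apply/colP => j; rewrite -normal_eqE h mxE.
rewrite mulmxBr mulmxA => /subr0_eq e.
by rewrite /xstar -mulmxA -e mulKmx ?gram_unit.
Qed.

Lemma m_gt0 : (0 < m)%N.
Proof.
rewrite lt0n; apply/eqP => m0; apply: hr; exists 0 => i; exfalso.
by have := leq_ltn_trans (leq0n i) (ltn_ord i); rewrite m0.
Qed.

Lemma mR_gt0 : 0 < m%:R :> R.
Proof. by rewrite ltr0n m_gt0. Qed.

Lemma rsqr_not_cst c : ~ forall i, r xs i ^+ 2 = c.
Proof.
move=> h; apply: hr; exists (Num.sqrt c) => i.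
by rewrite -(h i) sqrtr_sqr.
Qed.

Lemma Euw_gt0 : 0 < Euw A b.
Proof.
rewrite /Euw mulr_gt0 ?invr_gt0 ?mR_gt0 //.
rewrite lt_neqAle sumr_ge0 ?andbT => [|i _]; last exact: sqr_ge0.
apply/eqP => /esym/eqP; rewrite psumr_eq0 => [/allP h|i _]; last exact: sqr_ge0.
by apply: (rsqr_not_cst 0) => i; apply/eqP; exact: h (mem_index_enum i).
Qed.

Definition e2row : state R m n := mk_state 0 1 0 0.

Lemma lambda_e2row : lambda_of e2row = 0. Proof. exact: lambda_mk. Qed.
Lemma mu_e2row : mu_of e2row = 1. Proof. exact: mu_mk. Qed.
Lemma w_e2row i : w_of e2row i 0 = 0. Proof. by rewrite /e2row w_mk mxE. Qed.
Lemma x_e2row j : x_of e2row j 0 = 0. Proof. by rewrite /e2row x_mk mxE. Qed.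

Lemma w_ystar i : w_of (ystar A b) i 0 = m%:R^-1.
Proof. by rewrite state_mkE mxE. Qed.

Lemma x_ystar : x_of (ystar A b) = xs.
Proof. by rewrite state_mkE. Qed.

Lemma w_ystar_gt0 i : 0 < w_of (ystar A b) i 0.
Proof. by rewrite w_ystar invr_gt0 mR_gt0. Qed.

Lemma sum_uniform : \sum_(i < m) m%:R^-1 = 1 :> R.
Proof. by rewrite sumr_const card_ord -(mulr_natr m%:R^-1) mulVf // gt_eqF // mR_gt0. Qed.

Lemma Fsys_ystar : Fsys A b 0 (ystar A b) = Euw A b *: e2row.
Proof.
apply: state_ext => [| |i|j].
- rewrite lambdaZ lambda_Fsys lambda_e2row mulr0.
  by under eq_bigr do rewrite w_ystar; rewrite sum_uniform subrr.
- rewrite muZ mu_Fsys mu_e2row mulr1 subr0 /Euw mulr_sumr x_ystar.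
  by apply: eq_bigr => i _; rewrite w_ystar.
- rewrite wZi w_Fsys w_ystar w_e2row mulr0 [lambda_of _]lambda_mk [mu_of _]mu_mk; ring.
- rewrite xZi x_Fsys x_e2row mulr0.
  transitivity (m%:R^-1 * \sum_i A i j * r xs i); last by rewrite normal_eq mulr0.
  by rewrite mulr_sumr; apply: eq_bigr => i _; rewrite w_ystar x_ystar; ring.
Qed.

(** At y^* one has mu = 0 and A^T r^* = 0, so the equations for a kernel
    vector decouple: testing the third block against the w-part shows that
    this part vanishes, then lambda + mu |r_i^*|^2 = 0 for all i forces
    lambda = mu = 0 because |r^*| is not constant, and x = 0 by full rank. *)
Lemma jacobian_ystar_unit : 'J (Fsys A b 0) (ystar A b) \in unitmx.
Proof.
rewrite -row_free_unit; apply/inj_row_free => v.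
rewrite (mulmx_jacobian_Fsys _ _ _ _ _ w_ystar_gt0) => dF0.
have rs i : resid A b (x_of (ystar A b)) i = r xs i by rewrite x_ystar.
have slope_orth : \sum_i r xs i * slope A (x_of v) i = 0.
  have -> : \sum_i r xs i * slope A (x_of v) i =
      \sum_j x_of v j 0 * \sum_i A i j * r xs i.
    transitivity (\sum_i \sum_j x_of v j 0 * (A i j * r xs i)).
      apply: eq_bigr => i _; rewrite /slope mxE mulr_sumr.
      by apply: eq_bigr => j _; ring.
    by rewrite exchange_big; apply: eq_bigr => j _; rewrite mulr_sumr.
  by rewrite big1 // => j _; rewrite normal_eq mulr0.
have h1 : \sum_i w_of v i 0 = 0.
  by rewrite -(lambda_dF A b (ystar A b)) dF0 lambda_ofE mxE.
have h2 : \sum_i w_of v i 0 * r xs i ^+ 2 = 0.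
  have : mu_of (dF A b (ystar A b) v) = 0 by rewrite dF0 mu_ofE mxE.
  rewrite mu_dF big_split /= => h; rewrite -[RHS]h.
  rewrite [X in _ = _ + X](_ : _ = 0) ?addr0.
    by apply: eq_bigr => i _; rewrite rs.
  transitivity (m%:R^-1 * 2 * \sum_i r xs i * slope A (x_of v) i); last first.
    by rewrite slope_orth mulr0.
  by rewrite mulr_sumr; apply: eq_bigr => i _; rewrite w_ystar rs; ring.
have h3 i : m%:R * w_of v i 0 + lambda_of v + mu_of v * r xs i ^+ 2 = 0.
  have : w_of (dF A b (ystar A b) v) i 0 = 0 by rewrite dF0 w_ofE mxE.
  rewrite w_dF w_ystar rs invrK [mu_of (ystar _ _)]mu_mk mul0r addr0 => <-.
  by rewrite [_ * m%:R]mulrC.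
have w0 i : w_of v i 0 = 0.
  have : \sum_i w_of v i 0 ^+ 2 = 0.
    have mn0 : m%:R != 0 :> R by rewrite gt_eqF // mR_gt0.
    apply: (mulfI mn0); rewrite mulr0 mulr_sumr.
    transitivity (\sum_i (- lambda_of v * w_of v i 0
                   - mu_of v * (w_of v i 0 * r xs i ^+ 2))).
      apply: eq_bigr => k _; have := h3 k => hk.
      have -> : m%:R * w_of v k 0 ^+ 2 = (m%:R * w_of v k 0) * w_of v k 0 by ring.
      have -> : m%:R * w_of v k 0 = - lambda_of v - mu_of v * r xs k ^+ 2.
        by apply/eqP; rewrite -subr_eq0 -hk; apply/eqP; ring.
      by ring.
    by rewrite sumrB -!mulr_sumr h1 h2 !mulr0 subrr.
  move/eqP; rewrite psumr_eq0 => [/allP/(_ i (mem_index_enum i))|k _]; last exact: sqr_ge0.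
  by rewrite sqrf_eq0 => /eqP.
have mu0 : mu_of v = 0.
  apply/eqP/negPn/negP => mun0.
  apply: (rsqr_not_cst (- lambda_of v / mu_of v)) => i.
  apply: (mulfI mun0); rewrite [RHS]mulrCA mulfV // mulr1.
  by have := h3 i; rewrite w0 mulr0 add0r => /eqP; rewrite addrC addr_eq0 => /eqP.
have la0 : lambda_of v = 0.
  by have := h3 (Ordinal m_gt0); rewrite w0 mu0 mulr0 mul0r add0r addr0.
have x0 : x_of v = 0.
  have : A^T *m (A *m x_of v) = 0.
    apply/colP => j; rewrite [RHS]mxE.
    have : x_of (dF A b (ystar A b) v) j 0 = 0 by rewrite dF0 x_ofE mxE.
    rewrite x_dF mxE => hj.
    have mn0 : m%:R^-1 != 0 :> R by rewrite gt_eqF // invr_gt0 mR_gt0.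
    apply: (mulfI mn0); rewrite mulr0 -[RHS]hj mulr_sumr.
    by apply: eq_bigr => i _; rewrite w0 w_ystar /slope mxE; ring.
  by rewrite mulmxA => h; rewrite -[x_of v](mulKmx gram_unit) h mulmx0.
apply: state_ext.
- by rewrite la0 lambda_ofE mxE.
- by rewrite mu0 mu_ofE mxE.
- by move=> i; rewrite w0 w_ofE mxE.
- by move=> j; rewrite x0 mxE x_ofE mxE.
Qed.

End LeastSquares.

(** * Uniform bound for weighted least squares *)

Lemma ultra_cvg_real {R : realType} {T : Type} (F : set_system T)
    (FU : UltraFilter F) (u : T -> R) (M : R) :
  (\forall t \near F, `|u t| <= M) -> exists l : R, u t @[t --> F] --> l.
Proof.
move=> uM.
have [|p [_ clp]] := segment_compact (a := - M) (b := M) (F := u @ F) _.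
  by apply: filterS uM => t; rewrite /= in_itv /= ler_norml.
exists p => B pB; have [//|FnB] := in_ultra_setVsetC (u @^-1` B) FU.
by have [q [qB nqB]] := clp (~` B) B FnB pB.
Qed.

Section Weighted.
Context {R : realType} {m n : nat}.
Variables (A : 'M[R]_(m, n)) (b : 'cV[R]_m).
Hypothesis hA : \rank A = n.
Local Notation r := (resid A b).
Local Notation sl := (slope A).

Lemma resid_slope x i : r x i = sl x i - b i 0.
Proof. by rewrite /resid /slope !mxE. Qed.

Lemma residB x x' i : r x i - r x' i = sl (x - x') i.
Proof. by rewrite !resid_slope slopeD -(scaleN1r x') slopeZ; ring. Qed.

Lemma slope_cvg {T : Type} (F : set_system T) (FF : Filter F) (x : T -> 'cV[R]_n) (l : 'cV[R]_n) i :
  (forall j, x t j 0 @[t --> F] --> l j 0) -> sl (x t) i @[t --> F] --> sl l i.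
Proof.
move=> h.
have -> : (fun t => sl (x t) i) = (fun t => \sum_j A i j * x t j 0).
  by apply/funext => t; rewrite /slope mxE.
rewrite /slope mxE; apply: cvg_sumR => j _; apply: cvgM => //; exact: cvg_cst.
Qed.

Lemma resid_cvg {T : Type} (F : set_system T) (FF : Filter F) (x : T -> 'cV[R]_n) (l : 'cV[R]_n) i :
  (forall j, x t j 0 @[t --> F] --> l j 0) -> r (x t) i @[t --> F] --> r l i.
Proof.
move=> /slope_cvg sc; have h := sc i.
have -> : (fun t => r (x t) i) = (fun t => sl (x t) i - b i 0).
  by apply/funext => t; exact: resid_slope.
by rewrite resid_slope; apply: cvgB => //; exact: cvg_cst.
Qed.

Lemma ultra_cvg_cV {T : Type} (F : set_system T) (FU : UltraFilter F)
    (x : T -> 'cV[R]_n) M :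
  (\forall t \near F, `|x t| <= M) ->
  exists l : 'cV[R]_n, forall j, x t j 0 @[t --> F] --> l j 0.
Proof.
move=> xM.
have h j : exists l : R, x t j 0 @[t --> F] --> l.
  apply: (ultra_cvg_real _ FU _ M); apply: filterS xM => t; apply: le_trans.
  exact: mx_coord_le.
exists (\col_j sval (cid (h j))) => j; rewrite mxE.
by case: cid.
Qed.

(** The stationarity condition A^T W r = 0 of weighted least squares. *)
Definition stationary (w : 'I_m -> R) (x : 'cV[R]_n) : Prop :=
  forall j, \sum_i A i j * (w i * r x i) = 0.

Lemma stationary_slope w x d : stationary w x ->
  \sum_i w i * r x i * sl d i = 0.
Proof.
move=> st; transitivity (\sum_j d j 0 * \sum_i A i j * (w i * r x i)); last first.
  by rewrite big1 // => j _; rewrite st mulr0.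
transitivity (\sum_i \sum_j d j 0 * (A i j * (w i * r x i))).
  by apply: eq_bigr => i _; rewrite /slope mxE mulr_sumr; apply: eq_bigr => j _; ring.
by rewrite exchange_big; apply: eq_bigr => j _; rewrite mulr_sumr.
Qed.

Lemma ultra_nat : exists F : set_system nat, UltraFilter F /\ \oo `<=` F.
Proof. exact: ultraFilterLemma. Qed.

(** Uniformity in the weights comes from a sign argument.  If the solutions
    were unbounded, let l be a limit of their directions.  The residual in row i
    is eventually dominated by its part along l, so it has the sign of the
    slope of l in every row where this slope is not 0.  The stationarity
    condition tested against l is then a sum of nonnegative terms, one of them
    positive, that vanishes. *)
Lemma stationary_bounded : exists M, forall w x,
  (forall i, 0 < w i) -> stationary w x -> `|x| <= M.
Proof.
apply: contrapT => nex.
have ex (k : nat) : exists wx : ('I_m -> R) * 'cV[R]_n,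
    [/\ forall i, 0 < wx.1 i, stationary wx.1 wx.2 & k.+1%:R < `|wx.2|].
  apply: contrapT => nk; apply: nex; exists k.+1%:R => w x w0 st.
  by rewrite leNgt; apply/negP => kx; apply: nk; exists (w, x).
pose w k := (sval (cid (ex k))).1; pose x k := (sval (cid (ex k))).2.
have wx k : [/\ forall i, 0 < w k i, stationary (w k) (x k) & k.+1%:R < `|x k|].
  by rewrite /w /x; case: cid.
have x0 k : 0 < `|x k| by have [_ _] := wx k; apply: le_lt_trans.
have [F [FU Foo]] := ultra_nat.
have FP : ProperFilter F by exact: ultra_proper.
pose d k := `|x k|^-1 *: x k.
have d1 k : `|d k| = 1.
  by rewrite normrZ normfV normr_id mulVf // gt_eqF.
have [l dl] : exists l : 'cV[R]_n, forall j, d t j 0 @[t --> F] --> l j 0.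
  apply: (ultra_cvg_cV F FU d 1); apply: (@nearW _ F) => t.
  by rewrite d1.
have inv0 : `|x k|^-1 @[k --> F] --> 0.
  apply: (cvg_trans (G := (fun k => `|x k|^-1) @ \oo)); first exact: cvg_app.
  apply: (@squeeze_cvgr _ _ _ _ (fun=> 0) (fun k => k.+1%:R^-1)).
  - apply: nearW => k; rewrite invr_ge0 normr_ge0 /=.
    by rewrite lef_pV2 ?posrE ?ltr0Sn ?x0 // ltW //; have [] := wx k.
  - exact: cvg_cst.
  - exact: cvg_harmonic.
(* The directions d k have norm 1, which survives in the limit. *)
have l0 : l != 0.
  apply/eqP => l0.
  have : \forall k \near F, forall j, `|d k j 0| <= 2^-1.
    apply: filter_forall => j; have /cvgrPdist_le := dl j.
    rewrite l0 mxE => /(_ 2^-1); rewrite invr_gt0 ltr0n => /(_ erefl).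
    by apply: filterS => k; rewrite sub0r normrN.
  move=> /filter_ex[k hk].
  have : `|d k| <= 2^-1.
    by apply: mx_norm_le => [|i j]; rewrite ?invr_ge0 // (ord1 j).
  by rewrite d1; lra.
have [i0 sli0] : exists i, sl l i != 0.
  apply: contrapT => h; move/eqP: l0; apply; apply: (col_inj A hA) => i.
  by apply/eqP/negPn/negP => hi; apply: h; exists i.
have rl i : `|x k|^-1 * r (x k) i @[k --> F] --> sl l i.
  have -> : (fun k => `|x k|^-1 * r (x k) i) = (fun k => sl (d k) i - `|x k|^-1 * b i 0).
    by apply/funext => k; rewrite resid_slope mulrBr /d slopeZ.
  rewrite -[X in _ --> X]subr0; apply: cvgB; first exact: slope_cvg.
  by rewrite -[X in _ --> X](mul0r (b i 0)); apply: cvgM => //; exact: cvg_cst.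
have pos : \forall k \near F, forall i, sl l i != 0 -> 0 < r (x k) i * sl l i.
  apply: filter_forall => i.
  have [->|sn0] := eqVneq (sl l i) 0; first exact: nearW.
  have s0 : 0 < sl l i * sl l i by rewrite -expr2 exprn_even_gt0.
  have : `|x k|^-1 * r (x k) i * sl l i @[k --> F] --> sl l i * sl l i.
    by apply: cvgM => //; exact: cvg_cst.
  move=> /(cvgr_gt _) => /(_ _ s0); apply: filterS => k.
  by rewrite -mulrA pmulr_rgt0 ?invr_gt0.
have [k hk] := filter_ex pos.
have [w0 st _] := wx k; have := stationary_slope _ _ l st.
apply/eqP; rewrite gt_eqF //.
have ge0 i : 0 <= w k i * r (x k) i * sl l i.
  have [->|sn0] := eqVneq (sl l i) 0; first by rewrite mulr0.
  by rewrite -mulrA mulr_ge0 ?ltW // hk.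
rewrite (bigD1 i0) //= ltr_pwDl ?sumr_ge0 //.
by rewrite -mulrA mulr_gt0 // hk.
Qed.

End Weighted.

(** * Absence of rays of critical states *)

Lemma expR_quad_lower {R : realType} (s : R) : `|s| <= 1 -> 1 + s + s ^+ 2 / 4 <= expR s.
Proof.
rewrite ler_norml => /andP[s1 s2].
have h : 1 + s / 2 <= expR (s / 2) by exact: expR_ge1Dx.
have h0 : 0 <= 1 + s / 2 by lra.
have -> : expR s = expR (s / 2) ^+ 2 by rewrite expr2 -expRD -splitr.
have -> : 1 + s + s ^+ 2 / 4 = (1 + s / 2) ^+ 2 by field.
by rewrite ler_sqr ?nnegrE ?expR_ge0.
Qed.

Lemma sqr_expR_cvg0 {R : realType} (d : R) : 0 < d ->
  k%:R ^+ 2 * expR (- (k%:R * d)) @[k --> \oo] --> (0 : R).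
Proof.
move=> d0.
apply: (@squeeze_cvgr _ _ _ _ (fun=> 0) (fun k => 27 / d ^+ 3 * k%:R^-1)).
- near=> k; rewrite mulr_ge0 ?expR_ge0 ?sqr_ge0 //=.
  have k0 : 0 < k%:R :> R by rewrite ltr0n; near: k; exact: nbhs_infty_gt.
  rewrite expRN.
  have h : k%:R * d / 3 <= expR (k%:R * d / 3).
    by apply: le_trans (expR_ge1Dx _); rewrite lerDr.
  have -> : expR (k%:R * d) = expR (k%:R * d / 3) ^+ 3.
    by rewrite -expRM_natl; congr expR; field.
  have kd0 : 0 < k%:R * d / 3 by rewrite divr_gt0 // mulr_gt0.
  rewrite ler_pdivrMr ?exprn_gt0 ?expR_gt0 //.
  apply: (le_trans (y := 27 / d ^+ 3 / k%:R * (k%:R * d / 3) ^+ 3)).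
    have dn0 : d != 0 by rewrite gt_eqF.
    have kn0 : k%:R != 0 :> R by rewrite gt_eqF.
    by rewrite le_eqVlt; apply/orP; left; apply/eqP; field; rewrite kn0 dn0.
  rewrite ler_wpM2l ?lerXn2r ?nnegrE ?expR_ge0 ?(ltW kd0) //.
  by rewrite divr_ge0 ?divr_ge0 ?exprn_ge0 // ltW.
- exact: cvg_cst.
- rewrite -[X in _ --> X](mulr0 (27 / d ^+ 3)); apply: cvgM; first exact: cvg_cst.
  apply/gtr0_cvgV0; last exact: cvgr_idn.
  by near=> k; rewrite ltr0n; near: k; exact: nbhs_infty_gt.
Unshelve. all: by end_near. Qed.

Section Ray.
Context {R : realType} {m n : nat}.
Variables (A : 'M[R]_(m, n)) (b : 'cV[R]_m).
Hypothesis hA : \rank A = n.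
Hypothesis hr : ~ exists c : R, forall i, `|rstar A b i 0| = c.
Local Notation r := (resid A b).
Local Notation sl := (slope A).

(** The states X k have multiplier k, and the same loss E and negative entropy
    h0 for all k.  The contradiction comes from two exact consequences of
    stationarity, one for the weights of X k and one for their limit. *)
Lemma no_critical_ray (E h0 : R) (X : nat -> 'cV[R]_n) (k0 : R) : 0 < E ->
  (forall k, k0 <= k%:R ->
    let w i := expR (h0 - k%:R * (r (X k) i ^+ 2 - E)) in
    [/\ \sum_i w i = 1, \sum_i w i * (r (X k) i ^+ 2 - E) = 0 &
        stationary A b w (X k)]) -> False.
Proof.
move=> E0 hX.
pose s k i := r (X k) i ^+ 2 - E.
pose w k i := expR (h0 - k%:R * s k i).
have w0 k i : 0 < w k i by exact: expR_gt0.
have [F [FU Foo]] := ultra_nat.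
have FP : ProperFilter F by exact: ultra_proper.
have k_large (M : R) : \forall k \near F, M <= k%:R.
  by apply: Foo; apply: nbhs_infty_ger.
have near_hyp : \forall k \near F, [/\ \sum_i w k i = 1, \sum_i w k i * s k i = 0 &
    stationary A b (w k) (X k)].
  by apply: filterS (k_large k0) => k /hX.
have [M hM] := stationary_bounded A b hA.
have [xi xiP] : exists l : 'cV[R]_n, forall j, X k j 0 @[k --> F] --> l j 0.
  apply: (ultra_cvg_cV F FU X M); apply: filterS near_hyp => k [_ _ st].
  exact: hM (w0 k) st.
pose rho i := r xi i.
have r_rho i : r (X k) i @[k --> F] --> rho i by exact: resid_cvg.
have kinv0 : k%:R^-1 @[k --> F] --> (0 : R).
  apply: (cvg_trans (G := (fun k : nat => k%:R^-1 : R) @ \oo)); first exact: cvg_app.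
  apply/gtr0_cvgV0; last exact: cvgr_idn.
  by near=> k; rewrite ltr0n; near: k; exact: nbhs_infty_gt.
have w_le1 : \forall k \near F, forall i, w k i <= 1.
  apply: filterS near_hyp => k [<- _ _] i.
  by rewrite (bigD1 i) //= lerDl sumr_ge0 // => j _; rewrite ltW.
have /fin_all_exists[om omP] i : exists l : R, w k i @[k --> F] --> l.
  apply: (ultra_cvg_real F FU _ 1); apply: filterS w_le1 => k /(_ i).
  by rewrite ger0_norm // ltW.
(* Since w k i <= 1, the exponents k (r_i^2 - E) stay above h0, so that
   S i = rho_i^2 - E cannot be negative. *)
have om_ge0 i : 0 <= om i.
  by apply: (cvgr_to_ge (omP i)); apply: nearW => k; exact: ltW.
have om_sum : \sum_i om i = 1.
  have h : \sum_i w k i @[k --> F] --> \sum_i om i by apply: cvg_sumR.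
  have h1 : \sum_i w k i @[k --> F] --> (1 : R).
    by apply: cvg_near_cst; apply: filterS near_hyp => k [].
  exact: (cvg_unique _ h h1).
have om_st : stationary A b om xi.
  move=> j.
  have h : \sum_i A i j * (w k i * r (X k) i) @[k --> F] --> \sum_i A i j * (om i * r xi i).
    apply: cvg_sumR => i _; apply: cvgM; first exact: cvg_cst.
    by apply: cvgM => //; exact: r_rho.
  have h1 : \sum_i A i j * (w k i * r (X k) i) @[k --> F] --> (0 : R).
    by apply: cvg_near_cst; apply: filterS near_hyp => k [_ _ ->].
  exact: (cvg_unique _ h h1).
pose S i := rho i ^+ 2 - E.
have s_S i : s k i @[k --> F] --> S i.
  by apply: cvgB; [rewrite expr2; apply: cvgM|exact: cvg_cst].
have S_ge0 i : 0 <= S i.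
  have h : h0 * k%:R^-1 @[k --> F] --> h0 * 0 by apply: cvgM => //; exact: cvg_cst.
  rewrite mulr0 in h; apply: (ler_cvg_to h (s_S i)).
  apply: filterS2 w_le1 (k_large 1) => k /(_ i) wk1 k1.
  have kp : 0 < k%:R :> R by apply: lt_le_trans k1.
  have : w k i <= expR 0 by rewrite expR0.
  by rewrite ler_expR subr_le0 => h1; rewrite ler_pdivrMr // mulrC.
(* First identity: the linear term of the expansion of r_i^2 around rho_i
   is orthogonal to the slopes by stationarity at X k. *)
have quad : \forall k \near F, \sum_i w k i * S i = \sum_i w k i * (r (X k) i - rho i) ^+ 2.
  apply: filterS near_hyp => k [_ ws st].
  have := stationary_slope A b _ _ (xi - X k) st.
  under eq_bigr do rewrite -(residB A b).
  move=> st'; apply/eqP; rewrite -subr_eq0; apply/eqP.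
  transitivity (\sum_i w k i * s k i
    + 2 * \sum_i w k i * r (X k) i * (r xi i - r (X k) i)); last first.
    by rewrite ws st' mulr0 addr0.
  rewrite mulr_sumr -sumrB -big_split /=.
  by apply: eq_bigr => i _; rewrite /S /s /rho; ring.
(* Where S i > 0 the weights decay exponentially in k, so the left side of the
   first identity stays negligible even after multiplication by k^2. *)
have k2w i : 0 < S i -> k%:R ^+ 2 * w k i @[k --> F] --> (0 : R).
  move=> Si; have d0 : 0 < S i / 2 by rewrite divr_gt0.
  apply: (@squeeze_cvgr _ _ _ _ (fun=> 0)
    (fun k => expR h0 * (k%:R ^+ 2 * expR (- (k%:R * (S i / 2)))))).
  - have h : \forall k \near F, S i / 2 <= s k i.
      have /(cvgr_ge _) := s_S i; apply.
      by rewrite ltr_pdivrMr // mulr_natr mulr2n ltrDl.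
    apply: filterS h => k hk; rewrite mulr_ge0 ?sqr_ge0 ?(ltW (w0 _ _)) //=.
    rewrite mulrCA ler_wpM2l ?sqr_ge0 // -expRD ler_expR lerD2l lerN2.
    by rewrite ler_wpM2l.
  - exact: cvg_cst.
  - rewrite -[X in _ --> X](mulr0 (expR h0)); apply: cvgM; first exact: cvg_cst.
    apply: (cvg_trans (G := (fun k : nat => k%:R ^+ 2 * expR (- (k%:R * (S i / 2)))) @ \oo)).
      exact: cvg_app.
    exact: sqr_expR_cvg0.
have quad0 : \sum_i k%:R ^+ 2 * w k i * S i @[k --> F] --> (0 : R).
  suff h : \sum_i k%:R ^+ 2 * w k i * S i @[k --> F] --> \sum_(i < m) (0 : R).
    by rewrite big1_eq in h.
  apply: cvg_sumR => i _; have := S_ge0 i; rewrite le_eqVlt => /orP[/eqP <-|Si].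
    by under eq_fun do rewrite mulr0; exact: cvg_cst.
  rewrite -[X in _ --> X](mul0r (S i)); apply: cvgM; [exact: k2w|exact: cvg_cst].
have wk2 i : w k i * (k%:R * (r (X k) i - rho i)) ^+ 2 @[k --> F] --> (0 : R).
  apply: (@squeeze_cvgr _ _ _ _ (fun=> 0) _ _ _ _ _ quad0); last exact: cvg_cst.
  apply: filterS quad => k hk; rewrite mulr_ge0 ?sqr_ge0 ?(ltW (w0 _ _)) //=.
  under eq_bigr do rewrite -mulrA.
  rewrite -mulr_sumr hk (bigD1 i) //= exprMn [leRHS]mulrDr mulrCA lerDl.
  by rewrite mulr_ge0 ?sqr_ge0 // sumr_ge0 // => j _; rewrite mulr_ge0 ?sqr_ge0 // ltW.
(* Where S i = 0, sg k i = - k (r_i - rho_i) (r_i + rho_i), so that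
   w k i * sg k i ^+ 2 tends to 0: on the support of om the exponents vanish in
   the limit and om equals expR h0. *)
pose sg k i := - (k%:R * s k i).
have om_pos i : 0 < om i -> [/\ S i = 0, om i = expR h0 & sg k i @[k --> F] --> (0 : R)].
  move=> omi.
  have Si : S i = 0.
    apply/eqP/negPn/negP => Sn0.
    have Sp : 0 < S i by rewrite lt_neqAle eq_sym Sn0 S_ge0.
    have : om i <= 0.
      apply: (ler_cvg_to (omP i) (k2w _ Sp)).
      apply: filterS (k_large 1) => k k1.
      by rewrite ler_peMl ?(ltW (w0 _ _)) // exprn_ege1.
    by rewrite leNgt omi.
  have sgw : w k i * sg k i ^+ 2 @[k --> F] --> (0 : R).
    have h : w k i * (k%:R * (r (X k) i - rho i)) ^+ 2 * (r (X k) i + rho i) ^+ 2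
        @[k --> F] --> 0 * (rho i + rho i) ^+ 2.
      apply: cvgM; first exact: wk2.
      by rewrite expr2; apply: cvgM; apply: cvgD => //; exact: cvg_cst.
    rewrite mul0r in h; apply: cvg_trans h; apply: near_eq_cvg; apply: nearW => k.
    have rE : E = rho i ^+ 2 by apply/esym/eqP; rewrite -subr_eq0 -Si.
    by rewrite /sg /s rE; ring.
  have sg2 : sg k i ^+ 2 @[k --> F] --> (0 : R).
    have h : (w k i)^-1 * (w k i * sg k i ^+ 2) @[k --> F] --> (om i)^-1 * 0.
      by apply: cvgM => //; apply: cvgV => //; rewrite gt_eqF.
    rewrite mulr0 in h; apply: cvg_trans h; apply: near_eq_cvg; apply: nearW => k.
    by rewrite mulKf // gt_eqF.
  have sg0 : sg k i @[k --> F] --> (0 : R).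
    apply/cvgrPdist_le => e e0; have /cvgrPdist_le/(_ _ (exprn_gt0 2 e0)) := sg2.
    apply: filterS => k; rewrite !sub0r !normrN normrX => h.
    rewrite -normrN -/(sg k i); move: h.
    by rewrite ler_sqr ?nnegrE ?normr_ge0 ?(ltW e0).
  split=> //.
  have h : w k i @[k --> F] --> expR (h0 + 0).
    apply: (@cvg_comp _ _ _ (fun k => h0 + sg k i) (@expR R)); last exact: continuous_expR.
    by apply: cvgD => //; exact: cvg_cst.
  by rewrite addr0 in h; exact: (cvg_unique _ (omP i) h).
pose P i := 0 < om i.
have omNP i : ~~ P i -> om i = 0.
  by rewrite /P -leNgt => h; apply/eqP; rewrite eq_le h om_ge0.
have sumP (f : 'I_m -> R) : \sum_i om i * f i = expR h0 * \sum_(i | P i) f i.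
  rewrite (bigID P) /= [X in _ + X]big1 ?addr0 => [|i /omNP ->]; last by rewrite mul0r.
  by rewrite mulr_sumr; apply: eq_bigr => i Pi; have [_ -> _] := om_pos i Pi.
have cardP : expR h0 * \sum_(i | P i) 1 = 1.
  by rewrite -sumP; under eq_bigr do rewrite mulr1.
have sg_small : \forall k \near F, forall i, P i -> `|sg k i| <= 1.
  apply: filter_forall => i; have [Pi|nPi] := boolP (P i); last exact: nearW.
  have [_ _ /cvgrPdist_le/(_ _ ltr01)] := om_pos i Pi.
  by apply: filterS => k; rewrite sub0r normrN.
have sum_large : \forall k \near F, forall i, P i -> E <= (r (X k) i + rho i) ^+ 2.
  apply: filter_forall => i; have [Pi|nPi] := boolP (P i); last exact: nearW.
  have h : (r (X k) i + rho i) ^+ 2 @[k --> F] --> (rho i + rho i) ^+ 2.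
    by rewrite expr2; apply: cvgM; apply: cvgD => //; exact: cvg_cst.
  have lt : E < (rho i + rho i) ^+ 2.
    have [Si _ _] := om_pos i Pi.
    have -> : (rho i + rho i) ^+ 2 = 4 * E.
      have rE : E = rho i ^+ 2 by apply/esym/eqP; rewrite -subr_eq0 -Si.
      by rewrite rE; ring.
    by lra.
  have /(cvgr_gt _)/(_ _ lt) := h.
  by apply: filterS => k /ltW.
have near_all : \forall k \near F,
   ([/\ \sum_i w k i = 1, \sum_i w k i * s k i = 0 & stationary A b (w k) (X k)]
    /\ (8 / E + 1 <= k%:R)) /\
   ((forall i, P i -> `|sg k i| <= 1) /\
    (forall i, P i -> E <= (r (X k) i + rho i) ^+ 2)).
  by apply: filterI; apply: filterI => //; exact: k_large.
have [k [[[wsum _ wst] kE] [sg1 sumE]]] := filter_ex near_all.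
have k0' : 0 < k%:R :> R.
  by apply: lt_le_trans kE; rewrite ltr_wpDl // divr_ge0 // ltW.
have kE8 : 8 <= k%:R * E.
  by rewrite -ler_pdivrMr //; apply: le_trans kE; rewrite lerDl.
pose Q := \sum_(i | P i) sg k i ^+ 2.
(* Second identity: stationarity of the limit state tested against X k - xi. *)
have sum_sg : \sum_(i | P i) sg k i = - (k%:R * \sum_(i | P i) (r (X k) i - rho i) ^+ 2).
  have e0 : expR h0 != 0 :> R by rewrite gt_eqF // expR_gt0.
  have st0 : \sum_(i | P i) rho i * (r (X k) i - rho i) = 0.
    apply: (mulfI e0); rewrite mulr0 -sumP.
    have := stationary_slope A b _ _ (X k - xi) om_st.
    under eq_bigr do rewrite -(residB A b).
    by move=> st; rewrite -[RHS]st; apply: eq_bigr => i _; rewrite /rho mulrA.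
  transitivity (- (k%:R * (\sum_(i | P i) (r (X k) i - rho i) ^+ 2
    + 2 * \sum_(i | P i) rho i * (r (X k) i - rho i)))); last first.
    by rewrite st0 mulr0 addr0.
  rewrite mulr_sumr -big_split /= mulr_sumr -sumrN; apply: eq_bigr => i Pi.
  have [Si _ _] := om_pos i Pi.
  have rE : E = rho i ^+ 2 by apply/esym/eqP; rewrite -subr_eq0 -Si.
  by rewrite /sg /s rE; ring.
(* r_i - rho_i = (r_i^2 - E) / (r_i + rho_i) and (r_i + rho_i)^2 >= E. *)
have ub : k%:R * \sum_(i | P i) (r (X k) i - rho i) ^+ 2 <= Q / 8.
  rewrite mulr_sumr /Q mulr_suml; apply: ler_sum => i Pi.
  have [Si _ _] := om_pos i Pi.
  have rE : E = rho i ^+ 2 by apply/esym/eqP; rewrite -subr_eq0 -Si.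
  have -> : sg k i ^+ 2 = (k%:R * (r (X k) i - rho i) ^+ 2) * (k%:R * (r (X k) i + rho i) ^+ 2).
    by rewrite /sg /s rE; ring.
  have kd0 : 0 <= k%:R * (r (X k) i - rho i) ^+ 2.
    by apply: mulr_ge0; [exact: ltW|exact: sqr_ge0].
  rewrite -[leRHS]mulrA ler_peMr //.
  by rewrite ler_pdivlMr // mul1r (le_trans kE8) // ler_pM2l // sumE.
(* The exp sg_i over the support sum to at most its cardinal, as the
   remaining weights take a nonnegative share of the mass. *)
have lb : \sum_(i | P i) (sg k i + sg k i ^+ 2 / 4) <= 0.
  have : \sum_(i | P i) (1 + sg k i + sg k i ^+ 2 / 4) <= \sum_(i | P i) expR (sg k i).
    by apply: ler_sum => i Pi; apply: expR_quad_lower; exact: sg1.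
  have : \sum_(i | P i) expR (sg k i) <= \sum_(i | P i) 1.
    rewrite -(ler_pM2l (expR_gt0 h0)) cardP -wsum mulr_sumr [leRHS](bigID P) /=.
    rewrite -[leLHS]addr0 lerD //.
      by rewrite le_eqVlt; apply/orP; left; apply/eqP; apply: eq_bigr => i _; rewrite -expRD.
    by apply: sumr_ge0 => i _; rewrite ltW.
  move=> h1 h2; have := le_trans h2 h1.
  under eq_bigr do rewrite -addrA.
  by rewrite big_split /= gerDl.
have Q0 : Q = 0.
  have Qge : 0 <= Q by apply: sumr_ge0 => i _; exact: sqr_ge0.
  move: lb; rewrite big_split /= sum_sg -mulr_suml -/Q => lb.
  by apply/eqP; rewrite eq_le Qge andbT; lra.
have sg0 i : P i -> sg k i = 0.
  move=> Pi; move/eqP: Q0; rewrite psumr_eq0 => [|j _]; last exact: sqr_ge0.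
  by move=> /allP/(_ i (mem_index_enum i)); rewrite Pi /= sqrf_eq0 => /eqP.
have wP i : P i -> w k i = expR h0 by move=> /sg0; rewrite /w -/(sg k i) => ->; rewrite addr0.
(* The weights on the support now have total mass 1, so nothing is left for
   an index outside of it, whose weight is nevertheless positive. *)
have allP i : P i.
  apply/negPn/negP => nPi.
  have : 1 < \sum_i w k i.
    rewrite [ltRHS](bigID P) /= -{1}cardP mulr_sumr.
    have -> : \sum_(i | P i) expR h0 * 1 = \sum_(i | P i) w k i.
      by apply: eq_bigr => j /wP ->; rewrite mulr1.
    rewrite ltrDl (bigD1 i) //= ltr_pwDl // sumr_ge0 // => j _; exact: ltW.
  by rewrite wsum ltxx.
have rE i : r (X k) i ^+ 2 = E.
  have /eqP := sg0 i (allP i); rewrite oppr_eq0 mulf_eq0 gt_eqF //= subr_eq0.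
  by move/eqP.
apply: (rsqr_not_cst A b hr E) => i; rewrite -(normal_eq_unique A b hA (X k)) //.
move=> j; have e0 : expR h0 != 0 :> R by rewrite gt_eqF // expR_gt0.
apply: (mulfI e0); rewrite mulr0 -[RHS](wst j) mulr_sumr.
by apply: eq_bigr => l _; rewrite wP //; ring.
Unshelve. all: by end_near. Qed.

End Ray.

(** * States on the solution curve *)

Section Curve.
Context {R : realType} {m n : nat}.
Variables (A : 'M[R]_(m, n)) (b : 'cV[R]_m).
Hypothesis hA : \rank A = n.
Hypothesis hr : ~ exists c : R, forall i, `|rstar A b i 0| = c.
Local Notation r := (resid A b).
Local Notation sl := (slope A).
Local Notation F := (Fsys A b 0).
Local Notation ys := (ystar A b).
Local Notation Eu := (Euw A b).

Definition positive_weights : set (state R m n) :=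
  [set y | forall i, 0 < w_of y i 0].

Definition jac (y : state R m n) : 'M[R]_(1 + 1 + m + n) := 'J F y.

Definition level_branch (a : R) (y : R -> state R m n) : Prop :=
  branch F jac positive_weights e2row ys Eu a y.

Lemma open_positive_weights : open positive_weights.
Proof.
rewrite openE => y yw.
apply: (@filter_forall _ _ _ (nbhs y)) => i.
have c : w_of z i 0 @[z --> y] --> w_of y i 0.
  rewrite w_ofE; under eq_fun do rewrite w_ofE; exact: coord_continuous.
by have /(cvgr_gt _)/(_ _ (yw i)) := c.
Qed.

Lemma F_strict p : positive_weights p -> strict_diff F p (mulmxr (jac p)).
Proof.
move=> pw; rewrite /jac (jacobian_Fsys A b 0 p pw).
exact: Fsys_strict_diff.
Qed.

(** The constraint that the weights sum to 1 is the first component of the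
    level equation, so only positivity of the weights remains as an open
    condition on the state. *)
Lemma solution_onP a y : solution_on A b a y <-> level_branch a y.
Proof.
have F0 := Fsys_ystar A b hA hr.
have invE (z : state R m n) : (invmx (Jsys A b z) *m e2)^T = e2row *m invmx (jac z).
  by rewrite trmx_mul /e2 trmxK /Jsys -trmx_inv trmxK.
have unitE (z : state R m n) : (Jsys A b z \in unitmx) = (jac z \in unitmx).
  by rewrite /Jsys unitmx_tr.
split=> [[yb hy]|hy].
  apply: (flow_branch _ _ _ _ _ _ F_strict F0).
  split; first exact: yb.
  move=> E /hy[[wpos _]]; rewrite unitE invE => Ju q.
  by split; [split; [exact: wpos|exact: Ju]|exact: q].
have [yb hb] := hy.
have [_ hf] := branch_flow _ _ _ _ _ _ F_strict _ _ hy.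
split; first exact: yb.
move=> E aE; have [[[wpos Ju] q] [_ fE _]] := (hf E aE, hb E aE).
split; last by rewrite invE; exact: q.
- split; first exact: wpos.
  have := congr1 lambda_of fE.
  by rewrite lambda_Fsys lambdaZ lambda_e2row mulr0 => /eqP; rewrite subr_eq0 => /eqP.
- by rewrite unitE; exact: Ju.
Qed.

Section Level.
Variables (E : R) (y : state R m n).
Hypothesis wpos : forall i, 0 < w_of y i 0.
Hypothesis FE : F y = E *: e2row.
Local Notation w i := (w_of y i 0).
Local Notation la := (lambda_of y).
Local Notation mu := (mu_of y).
Local Notation x := (x_of y).

(** On the level of parameter E this is the negative entropy of the weights
    (neg_entropyE); in the present form it is a smooth function of lambda, mu
    and E only. *)
Definition neg_entropy (E : R) (y : state R m n) : R :=
  - (1 + lambda_of y) - mu_of y * E.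
Local Notation h := (neg_entropy E y).

Lemma level_sum : \sum_i w i = 1.
Proof.
have := congr1 lambda_of FE.
by rewrite lambda_Fsys lambdaZ lambda_e2row mulr0 => /eqP; rewrite subr_eq0 => /eqP.
Qed.

Lemma level_loss : \sum_i w i * r x i ^+ 2 = E.
Proof.
by have := congr1 mu_of FE; rewrite mu_Fsys subr0 muZ mu_e2row mulr1.
Qed.

Lemma level_centered : \sum_i w i * (r x i ^+ 2 - E) = 0.
Proof.
under eq_bigr do rewrite mulrBr.
by rewrite sumrB level_loss -mulr_suml level_sum mul1r subrr.
Qed.

Lemma level_ln i : ln (w i) = h - mu * (r x i ^+ 2 - E).
Proof.
have := congr1 (fun y => w_of y i 0) FE.
rewrite /= w_Fsys wZi w_e2row mulr0 /neg_entropy => H; lra.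
Qed.

Lemma level_gibbs i : w i = expR (h - mu * (r x i ^+ 2 - E)).
Proof. by rewrite -level_ln lnK // posrE. Qed.

Lemma level_stationary : stationary A b (fun i => w i) x.
Proof.
move=> j; have := congr1 (fun y => x_of y j 0) FE.
by rewrite /= x_Fsys xZi x_e2row mulr0.
Qed.

Lemma neg_entropyE : h = \sum_i w i * ln (w i).
Proof.
under eq_bigr do rewrite level_ln mulrBr mulrCA.
by rewrite sumrB -mulr_suml -mulr_sumr level_sum level_centered mul1r mulr0 subr0.
Qed.

Lemma weight_le1 i : w i <= 1.
Proof.
rewrite -level_sum (bigD1 i) //= lerDl sumr_ge0 // => j _; exact: ltW.
Qed.

Lemma neg_entropy_le0 : h <= 0.
Proof.
rewrite neg_entropyE; apply: sumr_le0 => i _.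
by rewrite mulr_ge0_le0 ?(ltW (wpos i)) // ln_le0 // weight_le1.
Qed.

(** Nonnegativity of the Kullback-Leibler divergence from the uniform
    distribution, through ln t <= t - 1. *)
Lemma neg_entropy_ge : - ln m%:R <= h.
Proof.
have m0 : 0 < m%:R :> R by exact: (mR_gt0 A b hr).
have -> : - ln m%:R = \sum_i w i * - ln m%:R by rewrite -mulr_suml level_sum mul1r.
rewrite neg_entropyE -subr_ge0 -sumrB.
apply: (@le_trans _ _ (\sum_i (w i - m%:R^-1))).
  by rewrite sumrB level_sum (sum_uniform A b hr) subrr.
apply: ler_sum => i _.
have mw : 0 < (m%:R * w i)^-1 by rewrite invr_gt0 mulr_gt0.
have : ln (m%:R * w i)^-1 <= (m%:R * w i)^-1 - 1.
  have := @le_ln1Dx R ((m%:R * w i)^-1 - 1).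
  by rewrite [1 + _]addrC subrK; apply; rewrite ltrBrDr addNr.
rewrite lnV ?posrE ?mulr_gt0 // lnM ?posrE // => H.
have := ler_wpM2l (ltW (wpos i)) H.
have -> : w i * ((m%:R * w i)^-1 - 1) = m%:R^-1 - w i.
  by field; rewrite !gt_eqF.
move: (ln m%:R) (ln (w i)) => L l; lra.
Qed.

(** With mu = 0 the Gibbs weights are uniform, hence x = x^*. *)
Lemma mu_eq0_level : mu = 0 -> E = Eu.
Proof.
move=> mu0; have wc i : w i = expR h by rewrite level_gibbs mu0 mul0r subr0.
have mh : m%:R * expR h = 1.
  rewrite -[RHS]level_sum; under [RHS]eq_bigr do rewrite wc.
  by rewrite sumr_const card_ord mulr_natl.
have xs : x = xstar A b.
  apply: (normal_eq_unique A b hA) => j.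
  have e0 : expR h != 0 :> R by rewrite gt_eqF // expR_gt0.
  apply: (mulfI e0); rewrite mulr0 -[RHS](level_stationary j) mulr_sumr.
  by apply: eq_bigr => i _; rewrite wc; ring.
have m0 : m%:R != 0 :> R by rewrite gt_eqF // (mR_gt0 A b hr).
rewrite -level_loss /Euw mulr_sumr; apply: eq_bigr => i _.
by rewrite wc xs; congr (_ * _); apply: (mulfI m0); rewrite mh mulfV.
Qed.

(** Envelope identity: the third block of the tangent equations, averaged with
    the weights, loses its x-part by stationarity and its w-part because the
    weights keep their sum.  Thus - (1 + lambda) - mu E varies only through its
    explicit dependence on E. *)
Lemma neg_entropy_tangent v : v *m jac y = e2row ->
  lambda_of v + mu_of v * E = 0.
Proof.
rewrite (mulmx_jacobian_Fsys A b 0 y v wpos) => dFv.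
have st := stationary_slope A b _ _ (x_of v) level_stationary.
have h1 : \sum_i w_of v i 0 = 0.
  by rewrite -(lambda_dF A b y) dFv lambda_e2row.
have h3 i : w_of v i 0 / w i + lambda_of v
   + (mu_of v * r x i ^+ 2 + mu * (2 * r x i * sl (x_of v) i)) = 0.
  by rewrite -(w_dF A b y) dFv w_e2row.
have : \sum_i (w_of v i 0 + lambda_of v * w i + mu_of v * (w i * r x i ^+ 2)
   + 2 * mu * (w i * r x i * sl (x_of v) i)) = 0.
  rewrite big1 // => i _; rewrite -[RHS](mulr0 (w i)) -(h3 i).
  have wn0 : w i != 0 by rewrite gt_eqF.
  by field.
by rewrite !big_split /= -!mulr_sumr h1 level_sum level_loss st add0r mulr1 mulr0 addr0.
Qed.

End Level.

End Curve.

(** * Multiplier and entropy along the curve *)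

Lemma within_segment {R : realType} (f : R -> R) (a b c d : R) :
  (forall E, a < E <= b -> f z @[z --> within [set` `]a, b]] (nbhs E)] --> f E) ->
  a < c -> d <= b -> {within `[c, d], continuous f}.
Proof.
move=> h ac db; apply/subspace_continuousP => x; rewrite /= in_itv /= => /andP[cx xd].
apply/cvgrPdist_le => e e0; rewrite /prop_near1 /within /=.
have axb : a < x <= b by rewrite (lt_le_trans ac cx) (le_trans xd).
have [t t0 ht] := (cvg_itv_oc a b x f (f x)).1 (h x axb) e e0.
apply/nbhs_ballP; exists t => // z; rewrite -ball_normE /= => zt.
rewrite in_itv /= => /andP[cz zd]; rewrite distrC; apply: ht; last by rewrite distrC.
by rewrite (lt_le_trans ac cz) (le_trans zd).
Qed.

Section AlongCurve.
Context {R : realType} {m n : nat}.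
Variables (A : 'M[R]_(m, n)) (b : 'cV[R]_m).
Hypothesis hA : \rank A = n.
Hypothesis hr : ~ exists c : R, forall i, `|rstar A b i 0| = c.
Local Notation r := (resid A b).
Local Notation ys := (ystar A b).
Local Notation Eu := (Euw A b).
Variables (a : R) (y : R -> state R m n).
Hypothesis aEu : a < Eu.
Hypothesis hy : level_branch A b a y.

Lemma curve_pos E : a < E <= Eu -> forall i, 0 < w_of (y E) i 0.
Proof. by move=> aE; have [_ h] := hy; have [[wpos _] _ _] := h E aE. Qed.

Lemma curve_level E : a < E <= Eu -> Fsys A b 0 (y E) = E *: e2row.
Proof. by move=> aE; have [_ h] := hy; have [_ fE _] := h E aE. Qed.

Lemma curve_end : y Eu = ys.
Proof. by have [] := hy. Qed.

Lemma curve_coord_cvg k E : a < E <= Eu ->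
  y z 0 k @[z --> within [set` `]a, Eu]] (nbhs E)] --> y E 0 k.
Proof.
move=> aE; have [_ h] := hy; have [_ _ /cvg_itv_oc c] := h E aE.
apply/cvg_itv_oc => e /c[t t0 ht]; exists t => // z azb zE.
apply: le_trans (ht z azb zE); rewrite -[y z 0 k - _]/(y z 0 k + - y E 0 k).
have -> : y z 0 k + - y E 0 k = (y z - y E) 0 k by rewrite !mxE.
exact: mx_coord_le.
Qed.

Definition velocity E : state R m n := e2row *m invmx (jac A b (y E)).

Lemma curve_coord_derive k E : a < E < Eu ->
  is_derive E 1 (fun z => y z 0 k) (velocity E 0 k).
Proof.
move=> /andP[aE Eb].
have [_ hf] := branch_flow _ _ _ _ _ _ (F_strict A b) _ _ hy.
have [|_ /cvg_itv_oc_punctured q] := hf E; first by rewrite aE ltW.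
apply: is_derive_local => e e0; have [t t0 ht] := q _ e0.
exists (Num.min t (Num.min (E - a) (Eu - E))); first by rewrite !lt_min t0 !subr_gt0 aE.
move=> z; rewrite !lt_min => /and3P[zt z1 z2].
have [->|zNE] := eqVneq z E; first by rewrite !subrr mul0r subrr normr0 mulr0.
have azb : a < z <= Eu.
  by move: z1 z2; rewrite !ltr_norml => /andP[? ?] /andP[? ?]; apply/andP; split; lra.
have := le_trans (mx_coord_le _ _ _ _ 0 k) (ht z azb zNE zt).
rewrite -/(velocity E); move: (velocity E) => V; rewrite !mxE => H.
have zn0 : z - E != 0 by rewrite subr_eq0.
have -> : y z 0 k - y E 0 k - (z - E) * V 0 k =
   (z - E) * ((z - E)^-1 * (y z 0 k - y E 0 k) - V 0 k) by field.
by rewrite normrM mulrC ler_wpM2r.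
Qed.

Definition curve_entropy E := neg_entropy E (y E).

Lemma curve_entropy_derive E : a < E < Eu ->
  is_derive E 1 curve_entropy (- mu_of (y E)).
Proof.
move=> aEb; have aE' : a < E <= Eu by case/andP: aEb => -> /ltW.
have dl := curve_coord_derive i_lambda E aEb.
have dm := curve_coord_derive i_mu E aEb.
have ju : jac A b (y E) \in unitmx.
  by have [_ h] := hy; have [[_ Ju] _ _] := h E aE'; exact: Ju.
have := neg_entropy_tangent A b E (y E) (curve_pos E aE') (curve_level E aE') (velocity E).
rewrite /velocity mulmxKV; last exact: ju.
move=> /(_ erefl); rewrite -/(velocity E) lambda_ofE mu_ofE => tg.
have -> : curve_entropy = (fun z => - (1 + y z 0 i_lambda) - y z 0 i_mu * z).
  by apply/funext => z; rewrite /curve_entropy /neg_entropy lambda_ofE mu_ofE.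
apply: is_derive_eq.
rewrite /GRing.scale /= mu_ofE; move: tg; set V := velocity E; lra.
Qed.

Lemma mu_coord : (fun E => mu_of (y E)) = (fun E => y E 0 i_mu).
Proof. by apply/funext => E; rewrite mu_ofE. Qed.

Lemma mu_within c d : a < c -> d <= Eu -> {within `[c, d], continuous (fun E => mu_of (y E))}.
Proof.
rewrite mu_coord; apply: within_segment => E aE; exact: curve_coord_cvg.
Qed.

Lemma entropy_within c d : a < c -> d <= Eu -> {within `[c, d], continuous curve_entropy}.
Proof.
apply: within_segment => E aE.
have -> : curve_entropy = (fun z => - (1 + y z 0 i_lambda) - y z 0 i_mu * z).
  by apply/funext => z; rewrite /curve_entropy /neg_entropy lambda_ofE mu_ofE.
apply: cvgB; last first.
  apply: cvgM; first exact: curve_coord_cvg.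
  by apply: cvg_within_filter; exact: cvg_id.
apply: cvgN; apply: cvgD; [exact: cvg_cst|exact: curve_coord_cvg].
Qed.

Lemma curve_entropy_mvt c d : a < c -> c < d -> d <= Eu ->
  exists2 t, c < t < d & curve_entropy d - curve_entropy c = - mu_of (y t) * (d - c).
Proof.
move=> ac cd dE.
have [t|t tcd e] := MVT cd _ (entropy_within c d ac dE) (df := fun t => - mu_of (y t)).
  rewrite in_itv /= => /andP[ct td]; apply: curve_entropy_derive.
  by rewrite (lt_trans ac) //= (lt_le_trans td).
by exists t => //; move: tcd; rewrite in_itv.
Qed.

Lemma curve_mu_neq0 E : a < E < Eu -> mu_of (y E) != 0.
Proof.
move=> /andP[aE Eb]; apply/eqP => mu0.
have aE' : a < E <= Eu by rewrite aE ltW.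
have := mu_eq0_level A b hA hr E (y E) (curve_pos E aE') (curve_level E aE') mu0.
by move=> EE; move: Eb; rewrite EE ltxx.
Qed.

(** If mu were negative somewhere, it would be negative up to Euw, where it
    first vanishes; then h would increase up to Euw, but there the weights are
    uniform and h has its minimal value - ln m. *)
Lemma curve_mu_gt0 E : a < E < Eu -> 0 < mu_of (y E).
Proof.
move=> aEb; have := curve_mu_neq0 E aEb; rewrite neq_lt => /orP[neg|//].
have [aE Eb] := andP aEb.
have allneg t : E < t < Eu -> mu_of (y t) < 0.
  move=> /andP[Et tb].
  have at' : a < t < Eu by rewrite (lt_trans aE).
  have := curve_mu_neq0 t at'; rewrite neq_lt => /orP[//|pos].
  have [] := IVT (v := 0) (ltW Et) (mu_within E t aE (ltW tb)).
    by rewrite ge_min le_max (ltW neg) (ltW pos) orbT.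
  move=> s; rewrite in_itv /= => /andP[Es st] mus.
  have := curve_mu_neq0 s; rewrite mus eqxx (lt_le_trans aE Es) (le_lt_trans st tb).
  by move=> /(_ isT).
have [t tE e] := curve_entropy_mvt E Eu aE Eb (lexx _).
have aE' : a < E <= Eu by rewrite aE ltW.
have low := neg_entropy_ge A b hr E (y E) (curve_pos E aE') (curve_level E aE').
have top : curve_entropy Eu = - ln m%:R.
  rewrite /curve_entropy /neg_entropy curve_end [lambda_of _]lambda_mk [mu_of _]mu_mk.
  rewrite mul0r subr0 lnV ?posrE ?(mR_gt0 A b hr) //; lra.
have : 0 < - mu_of (y t) * (Eu - E).
  by rewrite mulr_gt0 ?subr_gt0 // oppr_gt0 allneg.
by rewrite -e top /curve_entropy; move: low; lra.
Qed.

Lemma curve_entropy_noninc c d : a < c -> c <= d -> d <= Eu ->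
  curve_entropy d <= curve_entropy c.
Proof.
move=> ac; rewrite le_eqVlt => /orP[/eqP -> //|cd] dE.
have [t /andP[ct td] e] := curve_entropy_mvt c d ac cd dE.
rewrite -subr_le0 e mulr_le0_ge0 ?subr_ge0 ?(ltW cd) //.
rewrite oppr_le0 ltW // curve_mu_gt0 //.
by rewrite (lt_trans ac ct) (lt_le_trans td).
Qed.

(** h is monotone and bounded above by 0. *)
Lemma curve_entropy_cvg : exists h0 : R, curve_entropy E @[E --> a^'+] --> h0.
Proof.
have ab : (BRight a < BRight Eu)%O by rewrite bnd_simp.
eexists; apply: (nonincreasing_at_right_cvgr ab).
- move=> c d; rewrite !in_itv /= => /andP[ac cE] /andP[ad dE] dc.
  exact: curve_entropy_noninc.
- exists 0 => _ [E /= + <-]; rewrite in_itv /= => aE.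
  exact: (neg_entropy_le0 A b E (y E) (curve_pos E aE) (curve_level E aE)).
Qed.

End AlongCurve.

(** * Behaviour at a breakdown point *)

Lemma ultra_frequently {T : Type} (F : set_system T) {FF : Filter F} (D : set T) :
  (forall P, F P -> exists2 x, P x & D x) ->
  exists G, [/\ UltraFilter G, F `<=` G & G D].
Proof.
move=> freq.
have PF : ProperFilter (within D F).
  by apply: Build_ProperFilter_ex => P /freq[x DPx Dx]; exists x; exact: DPx.
have [G [GU FG]] := ultraFilterLemma PF.
exists G; split=> //; last by apply: FG; rewrite /within; exact: nearW.
by move=> P FP; apply: FG; apply: (@filterS _ F _ _ _ _ FP) => x Px _.
Qed.

Lemma not_near_ex {T : Type} (F : set_system T) {FF : Filter F} (D : set T) :
  ~ F D -> forall P, F P -> exists2 x, P x & ~ D x.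
Proof.
move=> nD P FP; apply: contrapT => h; apply: nD; apply: filterS FP => x Px.
by apply: contrapT => nDx; apply: h; exists x.
Qed.

Lemma near_right_itv {R : realType} (a c : R) : a < c ->
  \forall E \near a^'+, a < E < c.
Proof.
move=> ac; near=> E; apply/andP; split; near: E; first exact: nbhs_right_gt.
exact: nbhs_right_lt.
Unshelve. all: by end_near. Qed.

Section Breakdown.
Context {R : realType} {m n : nat}.
Variables (A : 'M[R]_(m, n)) (b : 'cV[R]_m).
Hypothesis hA : \rank A = n.
Hypothesis hr : ~ exists c : R, forall i, `|rstar A b i 0| = c.
Local Notation r := (resid A b).
Local Notation ys := (ystar A b).
Local Notation Eu := (Euw A b).
Variables (a : R) (y : R -> state R m n).
Hypothesis a_gt0 : 0 < a.
Hypothesis aEu : a < Eu.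
Hypothesis hy : level_branch A b a y.

Lemma curve_stationary E : a < E <= Eu ->
  stationary A b (fun i => w_of (y E) i 0) (x_of (y E)).
Proof. by move=> aE; apply: (level_stationary A b E); exact: (curve_level A b a y hy). Qed.

Lemma curve_x_bounded : exists M, forall E, a < E <= Eu -> `|x_of (y E)| <= M.
Proof.
have [M hM] := stationary_bounded A b hA; exists M => E aE.
by apply: (hM (fun i => w_of (y E) i 0)); [exact: (curve_pos A b a y hy)|exact: curve_stationary].
Qed.

(** Close to the left end there are parameters at which mu is below C and, on
    their left, others at which mu exceeds c, because mu is bounded on every
    segment [E1, Euw]; the intermediate value theorem fills the gap. *)
Lemma mu_oscillation C :
  (forall P : set R, (\forall E \near a^'+, P E) -> exists2 E, P E & ~ C <= mu_of (y E)) ->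
  (~ exists M, forall E, a < E <= Eu -> mu_of (y E) <= M) ->
  forall c, C <= c -> forall P : set R, (\forall E \near a^'+, P E) ->
    exists2 E, P E & mu_of (y E) = c.
Proof.
move=> freq unb c Cc P nP.
have [t /= t0 ht] : exists2 t, 0 < t & forall E, a < E < a + t -> P E.
  move: nP; rewrite /at_right /prop_near1 /within /= => /nbhs_ballP[t t0 ht].
  exists t => // E /andP[aE Et]; apply: ht => //=.
  by rewrite -ball_normE /= ltr_norml; apply/andP; split; lra.
have m0 : a < Num.min Eu (a + t) by rewrite lt_min aEu ltrDl.
have [E1 /andP[aE1]] := freq _ (near_right_itv _ _ m0).
rewrite lt_min => /andP[E1b E1t] /negP; rewrite -ltNge => muE1.
have [s] := EVT_max (ltW E1b) (mu_within A b a y hy E1 Eu aE1 (lexx _)).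
rewrite in_itv /= => sE smax.
pose B := Num.max (mu_of (y s)) c.
have [E2 /andP[aE2 E2b] muE2] : exists2 E2, a < E2 <= Eu & B < mu_of (y E2).
  apply: contrapT => h; apply: unb; exists B => E aE.
  by rewrite leNgt; apply/negP => BE; apply: h; exists E.
move: muE2; rewrite gt_max => /andP[mus muc].
have E21 : E2 < E1.
  rewrite ltNge; apply/negP => E12.
  have := smax E2; rewrite in_itv /= E12 E2b => /(_ isT).
  by rewrite leNgt mus.
have [] := IVT (v := c) (ltW E21) (mu_within A b a y hy E2 E1 aE2 (ltW E1b)).
  rewrite ge_min le_max (ltW muc) /= andbT; apply/orP; right.
  by rewrite ltW // (lt_le_trans muE1).
move=> E; rewrite in_itv /= => /andP[E2E EE1] muE; exists E => //.
by apply: ht; rewrite (lt_le_trans aE2) //= (le_lt_trans EE1).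
Qed.

(** Otherwise every large value of mu is attained arbitrarily close to a; along
    an ultrafilter of such parameters x converges, and the limits form a ray of
    critical states. *)
Lemma mu_dichotomy : mu_of (y E) @[E --> a^'+] --> +oo \/
  exists M, forall E, a < E <= Eu -> mu_of (y E) <= M.
Proof.
have [|ntend] := pselect (mu_of (y E) @[E --> a^'+] --> +oo); first by left.
have [|unb] := pselect (exists M, forall E, a < E <= Eu -> mu_of (y E) <= M); first by right.
exfalso.
have [C nC] : exists C, ~ \forall E \near a^'+, C <= mu_of (y E).
  apply: contrapT => h; apply: ntend; apply/cvgryPge => C.
  by apply: contrapT => nC; apply: h; exists C.
have freq : forall P : set R, (\forall E \near a^'+, P E) ->
    exists2 E, P E & ~ C <= mu_of (y E) by exact: not_near_ex nC.
have [h0 entropy_h0] := curve_entropy_cvg A b hA hr a y aEu hy.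
have [M hM] := curve_x_bounded.
have ex k : exists xk : 'cV[R]_n, C <= k%:R ->
    let w i := expR (h0 - k%:R * (r xk i ^+ 2 - a)) in
    [/\ \sum_i w i = 1, \sum_i w i * (r xk i ^+ 2 - a) = 0 & stationary A b w xk].
  have [Ck|nCk] := boolP (C <= k%:R :> R); last first.
    by exists 0 => h; case/negP: nCk.
  have [G [GU aG Gk]] : exists G : set_system R,
      [/\ UltraFilter G, a^'+ `<=` G & \forall E \near G, mu_of (y E) = k%:R].
    by apply: ultra_frequently; exact: (mu_oscillation C freq unb _ Ck).
  have GP : ProperFilter G by exact: ultra_proper.
  have Ga : \forall E \near G, a < E <= Eu.
    by apply: aG; apply: filterS (near_right_itv _ _ aEu) => E /andP[-> /ltW].
  have [xk xkP] : exists l : 'cV[R]_n, forall j, x_of (y E) j 0 @[E --> G] --> l j 0.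
    by apply: (ultra_cvg_cV G GU _ M); apply: filterS Ga => E; exact: hM.
  exists xk => _ w.
  have idG : E @[E --> G] --> a.
    apply: (cvg_trans (G := (id : R -> R) @ a^'+)); first exact: cvg_app.
    by apply: cvg_within_filter; exact: cvg_id.
  have hG : curve_entropy y E @[E --> G] --> h0.
    by apply: cvg_trans entropy_h0; exact: cvg_app.
  have rG i : r (x_of (y E)) i @[E --> G] --> r xk i by exact: resid_cvg.
  have sG i : r (x_of (y E)) i ^+ 2 - E @[E --> G] --> r xk i ^+ 2 - a.
    by apply: cvgB => //; rewrite expr2; apply: cvgM.
  have wG i : w_of (y E) i 0 @[E --> G] --> w i.
    have h : expR (curve_entropy y E - k%:R * (r (x_of (y E)) i ^+ 2 - E)) @[E --> G] --> w i.
      apply: (@cvg_comp _ _ _ _ (@expR R)); last exact: continuous_expR.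
      by apply: cvgB => //; apply: cvgM => //; exact: cvg_cst.
    apply: cvg_trans h; apply: near_eq_cvg; apply: filterS2 Ga Gk => E aE /= muE.
    rewrite (level_gibbs A b E (y E)) ?muE //; first exact: (curve_pos A b a y hy).
    exact: (curve_level A b a y hy).
  split.
  - have h : \sum_i w_of (y E) i 0 @[E --> G] --> \sum_i w i by apply: cvg_sumR.
    have h1 : \sum_i w_of (y E) i 0 @[E --> G] --> (1 : R).
      apply: cvg_near_cst; apply: filterS Ga => E aE.
      by apply: (level_sum A b E); exact: (curve_level A b a y hy).
    exact: (cvg_unique _ h h1).
  - have h : \sum_i w_of (y E) i 0 * (r (x_of (y E)) i ^+ 2 - E) @[E --> G]
        --> \sum_i w i * (r xk i ^+ 2 - a).
      by apply: cvg_sumR => i _; apply: cvgM.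
    have h1 : \sum_i w_of (y E) i 0 * (r (x_of (y E)) i ^+ 2 - E) @[E --> G] --> (0 : R).
      apply: cvg_near_cst; apply: filterS Ga => E aE.
      by apply: (level_centered A b E); exact: (curve_level A b a y hy).
    exact: (cvg_unique _ h h1).
  - move=> j.
    have h : \sum_i A i j * (w_of (y E) i 0 * r (x_of (y E)) i) @[E --> G]
        --> \sum_i A i j * (w i * r xk i).
      by apply: cvg_sumR => i _; apply: cvgM; [exact: cvg_cst|exact: cvgM].
    have h1 : \sum_i A i j * (w_of (y E) i 0 * r (x_of (y E)) i) @[E --> G] --> (0 : R).
      by apply: cvg_near_cst; apply: filterS Ga => E aE; exact: curve_stationary.
    exact: (cvg_unique _ h h1).
apply: (no_critical_ray A b hA hr a h0 (fun k => sval (cid (ex k))) C a_gt0) => k Ck.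
by case: cid => xk /= /(_ Ck).
Qed.

Lemma escape_of_mu : mu_of (y E) @[E --> a^'+] --> +oo -> escapes_to_infinity a y.
Proof.
move=> /cvgryPge h; apply/cvgryPge => C; apply: filterS (h C) => E /le_trans; apply.
by rewrite mu_ofE (le_trans (ler_norm _)) // mx_coord_le.
Qed.

Section BoundedMultiplier.
Variable C : R.
Hypothesis muC : forall E, a < E <= Eu -> mu_of (y E) <= C.

Lemma curve_mu_ge0 E : a < E <= Eu -> 0 <= mu_of (y E).
Proof.
move=> /andP[aE]; rewrite le_eqVlt => /orP[/eqP ->|Eb].
  by rewrite (curve_end A b a y hy) [mu_of _]mu_mk.
by apply/ltW/(curve_mu_gt0 A b hA hr a y hy); rewrite aE.
Qed.

(** With mu and x bounded, lambda = - 1 - h - mu E is bounded through the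
    bounds on the entropy. *)
Lemma curve_bounded : remains_bounded A b a y.
Proof.
have [M hM] := curve_x_bounded.
have C0 : 0 <= C.
  have aE : a < Eu <= Eu by rewrite aEu lexx.
  exact: le_trans (curve_mu_ge0 _ aE) (muC _ aE).
have M0 : 0 <= M.
  have aE : a < Eu <= Eu by rewrite aEu lexx.
  exact: le_trans (normr_ge0 _) (hM _ aE).
have L0 : 0 <= ln m%:R :> R by rewrite ln_ge0 // ler1n (m_gt0 A b hr).
have CE0 : 0 <= C * Eu by rewrite mulr_ge0 // ltW // (Euw_gt0 A b hr).
exists (1 + ln m%:R + C * Eu + C + M) => E aE.
have wpos := curve_pos A b a y hy E aE.
have FE := curve_level A b a y hy E aE.
have mu0 := curve_mu_ge0 E aE.
have E0 : 0 <= E by case/andP: aE => aE _; rewrite ltW // (lt_trans a_gt0).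
have muE0 : 0 <= mu_of (y E) * E by rewrite mulr_ge0.
have muE : mu_of (y E) * E <= C * Eu by case/andP: (aE) => _ EEu; rewrite ler_pM ?muC.
have e1 := neg_entropy_ge A b hr E _ wpos FE.
have e2 := neg_entropy_le0 A b E _ wpos FE.
rewrite /neg_entropy in e1 e2.
apply: mx_norm_le => [|i j]; first by rewrite !addr_ge0.
rewrite (ord1 i) {i}; move: j; apply: state_index => [| |i|j].
- by rewrite -lambda_ofE ler_norml; apply/andP; split; lra.
- by rewrite -mu_ofE ger0_norm //; have := muC E aE; lra.
- rewrite -w_ofE ger0_norm ?(ltW (wpos _)) //.
  by have := weight_le1 A b E _ wpos FE i; lra.
- rewrite -x_ofE (le_trans (mx_coord_le _ _ _ _ _ _)) //.
  by have := hM E aE; lra.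
Qed.

(** The Gibbs form bounds the weights from below, since h >= - ln m and the
    residuals are bounded. *)
Lemma curve_weights_away : exists2 d : R, 0 < d &
  forall E i, a < E <= Eu -> d <= w_of (y E) i 0.
Proof.
have [M hM] := curve_x_bounded.
have C0 : 0 <= C.
  have aE : a < Eu <= Eu by rewrite aEu lexx.
  exact: le_trans (curve_mu_ge0 _ aE) (muC _ aE).
pose N := n%:R * `|A^T| * M + `|b|.
exists (expR (- ln m%:R - C * N ^+ 2)) => [|E i aE]; first exact: expR_gt0.
have wpos := curve_pos A b a y hy E aE.
have FE := curve_level A b a y hy E aE.
rewrite (level_gibbs A b E _ wpos FE) ler_expR lerB //.
  exact: neg_entropy_ge A b hr E _ wpos FE.
have E0 : 0 <= E by case/andP: aE => aE _; rewrite ltW // (lt_trans a_gt0).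
have rN : r (x_of (y E)) i ^+ 2 <= N ^+ 2.
  rewrite -[leLHS]real_normK ?num_real // lerXn2r ?nnegrE //.
    rewrite addr_ge0 // !mulr_ge0 //; exact: le_trans (normr_ge0 _) (hM _ aE).
  rewrite resid_slope (le_trans (ler_normB _ _)) // lerD ?mx_coord_le //.
  have -> : slope A (x_of (y E)) i = ((x_of (y E))^T *m A^T) 0 i.
    by rewrite -trmx_mul mxE.
  rewrite (le_trans (mx_coord_le _ _ _ _ _ _)) // (le_trans (norm_mulmx_le _ _ _ _ _ _)) //.
  rewrite ler_wpM2l ?mulr_ge0 // (le_trans _ (hM _ aE)) //.
  by apply: mx_norm_le => // k l; rewrite mxE mx_coord_le.
apply: (le_trans (y := mu_of (y E) * N ^+ 2)); last by rewrite ler_wpM2r ?sqr_ge0 // muC.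
rewrite ler_wpM2l ?curve_mu_ge0 //; lra.
Qed.

(** If det J does not tend to 0, some ultrafilter keeps it away from 0, and
    the limit of y along it is a regular state of level a, through which the
    branch extends. *)
Lemma curve_singular :
  (forall a' z, 0 <= a' -> a' < a -> ~ level_branch A b a' z) ->
  becomes_singular A b a y.
Proof.
move=> noext; have [M bound] := curve_bounded.
have [d d0 wd] := curve_weights_away.
split; [exact: curve_bounded|exact: curve_weights_away|].
apply: contrapT => nsing.
have [e e0 ne] : exists2 e, 0 < e &
    ~ \forall E \near a^'+, `|0 - \det (Jsys A b (y E))| <= e.
  apply: contrapT => h; apply: nsing; apply/cvgrPdist_le => e e0.
  by apply: contrapT => ne; apply: h; exists e.
have [G [GU aG Ge]] : exists G : set_system R, [/\ UltraFilter G, a^'+ `<=` G &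
    \forall E \near G, ~ `|0 - \det (Jsys A b (y E))| <= e].
  by apply: ultra_frequently; exact: not_near_ex ne.
have GP : ProperFilter G by exact: ultra_proper.
have Ga : \forall E \near G, a < E <= Eu.
  by apply: aG; apply: filterS (near_right_itv _ _ aEu) => E /andP[-> /ltW].
have /fin_all_exists[p pP] k : exists l : R, y E 0 k @[E --> G] --> l.
  apply: (ultra_cvg_real G GU _ M); apply: filterS Ga => E aE.
  by rewrite (le_trans (mx_coord_le _ _ _ _ _ _)) // bound.
pose q : state R m n := \row_k p k.
have yq t : 0 < t -> \forall E \near G, `|y E - q| < t.
  move=> t0; have t20 : 0 < t / 2 by rewrite divr_gt0.
  have : \forall E \near G, forall k, `|p k - y E 0 k| <= t / 2.
    apply: filter_forall => k; have /cvgrPdist_le/(_ _ t20) := pP k; exact.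
  apply: filterS => E h; apply: (le_lt_trans (y := t / 2)); last first.
    by rewrite ltr_pdivrMr // mulr_natr mulr2n ltrDl.
  apply: mx_norm_le => [|i k]; first exact: ltW.
  by rewrite (ord1 i) !mxE distrC.
have cyq : y E @[E --> G] --> q.
  by apply/cvgrPdist_lt => t /yq; apply: filterS => E; rewrite distrC.
have qpos : positive_weights q.
  move=> i; apply: (lt_le_trans d0).
  apply: (cvgr_to_ge (f := fun E => w_of (y E) i 0) (F := G)).
    rewrite w_ofE mxE; under eq_fun do rewrite w_ofE; exact: pP.
  by apply: filterS Ga => E; exact: wd.
have idG : E @[E --> G] --> a.
  apply: (cvg_trans (G := (id : R -> R) @ a^'+)); first exact: cvg_app.
  by apply: cvg_within_filter; exact: cvg_id.
have Fq : Fsys A b 0 q = a *: e2row.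
  have h : Fsys A b 0 (y E) @[E --> G] --> Fsys A b 0 q.
    apply: (cvg_comp _ _ cyq).
    exact: strict_diff_cvg (F_strict A b q qpos) (mulmxr_bound _).
  have h1 : Fsys A b 0 (y E) @[E --> G] --> a *: e2row.
    have h2 : E *: e2row @[E --> G] --> a *: (e2row : state R m n).
      by apply: cvgZ => //; exact: cvg_cst.
    apply: cvg_trans h2; apply: near_eq_cvg; apply: filterS Ga => E aE.
    by rewrite (curve_level A b a y hy).
  exact: (cvg_unique _ h h1).
have Jq : jac A b q \in unitmx.
  have h : `|\det (jac A b (y E))| @[E --> G] --> `|\det (jac A b q)|.
    apply: cvg_norm.
    apply: (@cvg_comp _ _ _ y (fun z => \det (jac A b z)) _ _ _ cyq).
    exact: (cvg_det_jacobian _ _ _ open_positive_weights (F_strict A b) q qpos).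
  have : e <= `|\det (jac A b q)|.
    apply: (cvgr_to_ge h); apply: filterS Ge => E /negP.
    by rewrite -ltNge sub0r normrN /Jsys det_tr => /ltW.
  move=> eq; rewrite unitmxE unitfE -normr_gt0; exact: lt_le_trans eq.
have [|a' [z [a'0 a'a bz]]] := branch_extend _ _ _ _ _ _ open_positive_weights
   (F_strict A b) a y q a_gt0 aEu hy (conj qpos Jq) Fq.
  move=> t t0.
  have Gt : \forall E \near G, a < E < a + t.
    by apply: aG; apply: near_right_itv; rewrite ltrDl.
  have [E [[aE /andP[_ Et]] yE]] := filter_ex (filterI (filterI Ga Gt) (yq t t0)).
  by exists E.
exact: (noext a' z).
Qed.

End BoundedMultiplier.
End Breakdown.

Theorem theorem2 (R : realType) (m n : nat) (A : 'M[R]_(m, n)) (b : 'cV[R]_m)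
    (hmn : (n <= m)%N) (hA : \rank A = n)
    (hr : ~ exists c : R, forall i, `|rstar A b i 0| = c) :
  (exists (Emin : R) (y : R -> state R m n), maximal_solution A b Emin y) /\
  forall (Emin : R) (y : R -> state R m n), maximal_solution A b Emin y ->
    [/\ (forall (E0 : R) (z : R -> state R m n),
           0 <= E0 -> E0 < Euw A b -> solution_on A b E0 z ->
           Emin <= E0 /\ forall E, E0 < E <= Euw A b -> z E = y E),
        (finite_breakdown A b Emin \/ extension_to_zero A b Emin y) /\
          ~ (finite_breakdown A b Emin /\ extension_to_zero A b Emin y) &
        (finite_breakdown A b Emin ->
           [\/ escapes_to_infinity Emin y,
               approaches_boundary A b Emin y |
               becomes_singular A b Emin y])].
Proof.
have F0 := Fsys_ystar A b hA hr.
have solP a z := solution_onP A b hA hr a z.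
have agree a u z : level_branch A b a u -> level_branch A b a z ->
    forall E, a < E <= Euw A b -> u E = z E.
  by move=> bu bz; apply: (branch_unique _ _ _ _ _ _ (F_strict A b)) bu bz.
split.
  have reg0 : regular (jac A b) (positive_weights) (ystar A b).
    split; [exact: (w_ystar_gt0 A b hr)|exact: (jacobian_ystar_unit A b hA hr)].
  have [a [y [a0 aE ay amin]]] := maximal_branch_exists _ _ _ _ _ _
    open_positive_weights (F_strict A b) F0 reg0 (Euw_gt0 A b hr).
  exists a, y; split=> //; first exact/solP.
  move=> [E0 [z [E00 E0a /solP bz _]]].
  by have := amin E0 z E00 (lt_trans E0a aE) bz; rewrite leNgt E0a.
move=> Emin y [Emin0 EminE /solP by_ maxy].
have unique E0 z : 0 <= E0 -> E0 < Euw A b -> solution_on A b E0 z ->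
    Emin <= E0 /\ forall E, E0 < E <= Euw A b -> z E = y E.
  move=> E00 E0E sz; have /solP bz := sz.
  have [EE0|E0lt] := leP Emin E0.
    split=> //; apply: agree => //; exact: branch_restrict EE0 by_.
  exfalso; apply: maxy; exists E0, z; split=> //.
  by apply: agree => //; exact: branch_restrict (ltW E0lt) bz.
have nolower E0 z : 0 <= E0 -> E0 < Emin -> ~ solution_on A b E0 z.
  move=> E00 E0lt sz; have [] := unique E0 z E00 (lt_trans E0lt EminE) sz.
  by rewrite leNgt E0lt.
split=> //.
- split.
    move: (Emin0); rewrite le_eqVlt => /orP[/eqP Emin_eq0|pos]; last first.
      by left; split=> // E0 z; exact: nolower.
    right; split; [by rewrite Emin_eq0|by rewrite Emin_eq0; exact/solP|].
    by move=> z /(unique 0 z (lexx _) (Euw_gt0 A b hr)) [].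
  by move=> [[pos _] [Emin_eq0 _ _]]; move: pos; rewrite Emin_eq0 ltxx.
- move=> [pos _].
  have [tend|[C muC]] := mu_dichotomy A b hA hr Emin y pos EminE by_.
    by apply: Or31; exact: escape_of_mu.
  apply: Or33; apply: (curve_singular A b hA hr Emin y pos EminE by_ C muC).
  by move=> a' z a'0 a'E /solP; exact: nolower.
Qed.
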